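(* Consider the stochastic minimax problem $\min_{x\in\mathbb{R}^d}\max_{y\in\mathbb{R}^p} f(x,y)$ with $f(x,y)=\mathbb{E}_{\xi\sim\mathcal{D}}[f(x,y;\xi)]$, and let $F(x)=\max_{y}f(x,y)$. Assume: (A1) there is $\mu>0$ such that for every $x$ the set $\arg\max_y f(x,y)$ is nonempty and $\|\nabla_y f(x,y)\|^2\ge 2\mu\big(\max_{y'}f(x,y')-f(x,y)\big)$ for all $y$; (A2) for every $\xi$, the maps $\nabla_x f(\cdot,\cdot;\xi)$ and $\nabla_y f(\cdot,\cdot;\xi)$ are $L_f$-Lipschitz in each argument separately, i.e. $\|\nabla_x f(x_1,y;\xi)-\nabla_x f(x_2,y;\xi)\|\le L_f\|x_1-x_2\|$, $\|\nabla_x f(x,y_1;\xi)-\nabla_x f(x,y_2;\xi)\|\le L_f\|y_1-y_2\|$, and the same two inequalities with $\nabla_y$ in place of $\nabla_x$, for all $x,x_1,x_2,y,y_1,y_2$; (A3) $\mathbb{E}_\xi[\nabla f(x,y;\xi)]=\nabla f(x,y)$ and $\mathbb{E}_\xi\|\nabla f(x,y)-\nabla f(x,y;\xi)\|^2\le\sigma^2$ for all $x,y$, where $\nabla f=(\nabla_x f,\nabla_y f)$; (A4) $F^*=\inf_x F(x)>-\infty$. Let $\{x_t,y_t,\tilde x_t,w_t,v_t\}$ be generated by the MSGDA algorithm (described in the context) with $\eta_t=\frac{k}{(m+t)^{1/3}}$ for all $t\ge 0$, $\alpha_{t+1}=c_1\eta_t^2$, $\beta_{t+1}=c_2\eta_t^2$,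 where $k>0$, $m\ge\max\big(2,k^3,(c_1k)^3,(c_2k)^3\big)$, $c_1\ge\frac{2}{3k^3}+\frac{9L_f^2}{\mu^2}$, $c_2\ge\frac{2}{3k^3}+\frac94$, $0<\lambda\le\min\big(\frac{3}{4\sqrt2\,\mu},\frac{m^{1/3}}{2L_fk}\big)$ and $0<\gamma\le\min\big(\frac{\lambda\mu}{16L},\frac{1}{2L_f\sqrt{8+9/(8\lambda\mu^2)}}\big)$. Then for every $T\ge1$, $$\frac1T\sum_{t=1}^T\mathbb{E}\|\nabla F(x_t)\|\le\frac1T\sum_{t=1}^T\mathbb{E}[\mathcal{G}_t]\le\frac{2\sqrt{3H}\,m^{1/6}}{T^{1/2}}+\frac{2\sqrt{3H}}{T^{1/3}},$$ where $H=\frac{F(x_1)-F^*}{\gamma k}+\frac{9L_f^2}{k\lambda\mu^2}\Delta_1+\frac{2\sigma^2m^{1/3}}{k^2}+2k^2(c_1^2+c_2^2)\sigma^2\ln(m+T)$ and $\Delta_1=F(x_1)-f(x_1,y_1)$.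
   Context: $\kappa=L_f/\mu$ and $L=L_f(1+\kappa/2)$. For each $x$, $y^*(x)$ denotes an element of $\arg\max_y f(x,y)$, so $F(x)=f(x,y^*(x))$. MSGDA algorithm: given constants $\gamma,\lambda>0$, sequences $\eta_t>0$ and $\alpha_t,\beta_t\in(0,1]$, initial points $x_1\in\mathbb{R}^d,y_1\in\mathbb{R}^p$, and samples $\xi_1,\xi_2,\dots$ drawn i.i.d. from $\mathcal{D}$: set $v_1=\nabla_y f(x_1,y_1;\xi_1)$, $w_1=\nabla_x f(x_1,y_1;\xi_1)$, and for $t\ge1$: $\tilde y_{t+1}=y_t+\lambda v_t$, $\tilde x_{t+1}=x_t-\gamma w_t$; $y_{t+1}=y_t+\eta_t(\tilde y_{t+1}-y_t)$, $x_{t+1}=x_t+\eta_t(\tilde x_{t+1}-x_t)$; $v_{t+1}=\nabla_y f(x_{t+1},y_{t+1};\xi_{t+1})+(1-\alpha_{t+1})[v_t-\nabla_y f(x_t,y_t;\xi_{t+1})]$; $w_{t+1}=\nabla_x f(x_{t+1},y_{t+1};\xi_{t+1})+(1-\beta_{t+1})[w_t-\nabla_x f(x_t,y_t;\xi_{t+1})]$. The metric is $\mathcal{G}_t=\frac1\gamma\|x_t-\tilde x_{t+1}\|+\frac{\sqrt2L_f}{\sqrt\mu}\sqrt{F(x_t)-f(x_t,y_t)}+\|\nabla_x f(x_t,y_t)-w_t\|$. *)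

(* Defs.v *)
From HB Require Import structures.
From mathcomp Require Import all_boot all_order all_algebra.
From mathcomp Require Import all_classical all_reals all_analysis.
Set Implicit Arguments. Unset Strict Implicit. Unset Printing Implicit Defensive.
Import Order.TTheory GRing.Theory Num.Theory.
Import numFieldNormedType.Exports.
Local Open Scope classical_set_scope.
Local Open Scope ring_scope.

Section Defs.
Variable R : realType.

Definition enorm (n : nat) (v : 'rV[R]_n) : R :=
  Num.sqrt (\sum_(i < n) v ord0 i ^+ 2).

Definition gradient (n : nat) (F : 'rV[R]_n -> R) (x : 'rV[R]_n) : 'rV[R]_n :=
  \row_(i < n) ('D_(delta_mx ord0 i) F x).

Definition gradx (d p : nat) (g : 'rV[R]_d -> 'rV[R]_p -> R) x y : 'rV[R]_d :=
  gradient (fun x' => g x' y) x.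
Definition grady (d p : nat) (g : 'rV[R]_d -> 'rV[R]_p -> R) x y : 'rV[R]_p :=
  gradient (fun y' => g x y') y.

Definition iid_samples (dO dX : measure_display) (O : measurableType dO)
  (X : measurableType dX) (P : probability O R) (D : probability X R)
  (xi : nat -> O -> X) : Prop :=
  (forall t, measurable_fun setT (xi t)) /\
  forall (n : nat) (A : nat -> set X), (forall i, measurable (A i)) ->
    P (\bigcap_(i in [set i | (0 < i <= n)%N]) (xi i @^-1` A i)) =
    (\prod_(1 <= i < n.+1) D (A i))%E.

(* the metric G_t of the paper, with xtil = x_t - gamma w_t *)
Definition Gmetric (d p : nat) (f : 'rV[R]_d -> 'rV[R]_p -> R) (F : 'rV[R]_d -> R)
  (gamma mu Lf : R) (xt : 'rV[R]_d) (yt : 'rV[R]_p) (wt xtil : 'rV[R]_d) : R :=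
  gamma^-1 * enorm (xt - xtil)
  + (Num.sqrt 2 * Lf / Num.sqrt mu) * Num.sqrt (F xt - f xt yt)
  + enorm (gradx f xt yt - wt).

End Defs.

(* Main.v *)
(** The PL inequality at an old maximiser bounds the growth of [F = max_y f] from above
    by a quadratic, and [F >= f] bounds it from below: hence [F] is differentiable, with
    [gradient F x = gradx f x ys] for a maximiser [ys] of [f x]. A minimiser of
    [z |-> sqrt (F x - f x z) + c |z - y|] with [c < sqrt (mu / 2)] maximises [f x]; this
    gives quadratic growth and [|gradient F - gradx f|^2 <= (2 Lf^2 / mu) (F - f)], which
    is the first inequality. It also makes [F] smooth with constant [Lf (1 + kappa)];
    this exceeds the [L = Lf (1 + kappa / 2)] of the step-size conditions, but is at most
    [2 L], which they tolerate.

    For the second inequality the Lyapunov function is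
      [F - Fstar + A (F - f) + (gamma / eta_(t-1)) (|grady f - v|^2 + |gradx f - w|^2)]
    with [A = 9 gamma Lf^2 / (lambda mu^2)]. Tonelli's theorem on the product of the past
    of the first [t] samples with a fresh sample gives the contraction of the momentum
    errors in expectation; all other estimates are pointwise. Everything is nonnegative,
    so the telescoping takes place in the extended reals and needs no integrability of
    the iterates. *)
Require Import Defs.
From HB Require Import structures.
From mathcomp Require Import all_boot all_order all_algebra.
From mathcomp Require Import all_classical all_reals all_analysis.
From mathcomp Require Import measurable_realfun ring lra.
Import Order.TTheory GRing.Theory Num.Theory.
Import numFieldNormedType.Exports.
Set Implicit Arguments.
Unset Strict Implicit.
Unset Printing Implicit Defensive.
Local Open Scope classical_set_scope.
Local Open Scope ring_scope.

(** * Euclidean norm *)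

Section euclidean.
Context {R : realType} (n : nat).
Implicit Types (u v w : 'rV[R]_n) (a c : R).

Definition dotp u v : R := \sum_(i < n) u ord0 i * v ord0 i.

Lemma dotpC u v : dotp u v = dotp v u.
Proof. by apply: eq_bigr => i _; rewrite mulrC. Qed.

Lemma dotp_is_linear u : linear (dotp u).
Proof.
move=> a v w; rewrite scaler_sumr -big_split; apply: eq_bigr => i _.
by rewrite !mxE mulrDr mulrCA.
Qed.

HB.instance Definition _ u :=
  GRing.isLinear.Build R 'rV[R]_n R *:%R (dotp u) (dotp_is_linear u).

Lemma dotpDr u v w : dotp u (v + w) = dotp u v + dotp u w.
Proof. exact: linearD. Qed.

Lemma dotpDl u v w : dotp (u + v) w = dotp u w + dotp v w.
Proof. by rewrite dotpC dotpDr !(dotpC w). Qed.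

Lemma dotpZr a u v : dotp u (a *: v) = a * dotp u v.
Proof. exact: linearZ. Qed.

Lemma dotpZl a u v : dotp (a *: u) v = a * dotp u v.
Proof. by rewrite dotpC dotpZr dotpC. Qed.

Lemma dotpNr u v : dotp u (- v) = - dotp u v.
Proof. exact: linearN. Qed.

Lemma dotpNl u v : dotp (- u) v = - dotp u v.
Proof. by rewrite dotpC dotpNr dotpC. Qed.

Definition dotpE := (dotpDl, dotpDr, dotpZl, dotpZr, dotpNl, dotpNr).

Lemma dotp_delta u i : dotp u (delta_mx ord0 i) = u ord0 i.
Proof.
rewrite /dotp (bigD1 i)//= mxE !eqxx mulr1 big1 ?addr0// => j ji.
by rewrite mxE (negbTE ji) andbF mulr0.
Qed.

Lemma enorm_ge0 u : 0 <= enorm u.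
Proof. exact: sqrtr_ge0. Qed.

Lemma enorm_sqr u : enorm u ^+ 2 = dotp u u.
Proof.
rewrite /enorm sqr_sqrtr; first by apply: eq_bigr => i _; rewrite expr2.
by apply: sumr_ge0 => i _; exact: sqr_ge0.
Qed.

Lemma dotp_ge0 u : 0 <= dotp u u.
Proof. by rewrite -enorm_sqr sqr_ge0. Qed.

Lemma enorm_eq0 u : (enorm u == 0) = (u == 0).
Proof.
rewrite -sqrf_eq0 enorm_sqr; apply/idP/eqP => [|->]; last by rewrite linear0.
rewrite psumr_eq0 => [/allP u0|i _]; last by rewrite -expr2 sqr_ge0.
apply/rowP => i; rewrite mxE; apply/eqP.
by have := u0 i (mem_index_enum i); rewrite -expr2 sqrf_eq0.
Qed.

Lemma enorm0 : enorm (0 : 'rV[R]_n) = 0.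
Proof. by apply/eqP; rewrite enorm_eq0. Qed.

Lemma enormZ a u : enorm (a *: u) = `|a| * enorm u.
Proof.
apply/eqP; rewrite -(@eqrXn2 _ 2) ?mulr_ge0 ?enorm_ge0//.
by rewrite exprMn !enorm_sqr !dotpE mulrA real_normK ?num_real// expr2.
Qed.

Lemma enormN u : enorm (- u) = enorm u.
Proof. by rewrite -scaleN1r enormZ normrN1 mul1r. Qed.

Lemma CauchySchwarz_dotp u v : dotp u v <= enorm u * enorm v.
Proof.
have [v0|v0] := eqVneq (enorm v) 0.
  by move/eqP: (v0); rewrite enorm_eq0 => /eqP ->; rewrite linear0 mulr_ge0 ?enorm_ge0.
have {}v0 : 0 < enorm v by rewrite lt_def v0 enorm_ge0.
rewrite (le_trans (ler_norm _))// -(@ler_pXn2r _ 2) ?nnegrE ?mulr_ge0 ?enorm_ge0//.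
rewrite real_normK ?num_real// -subr_ge0 -(pmulr_rge0 _ (exprn_gt0 2 v0)).
have := dotp_ge0 (dotp v v *: u - dotp u v *: v).
by rewrite exprMn !enorm_sqr !dotpE (dotpC v u); lra.
Qed.

Lemma enormD u v : enorm (u + v) <= enorm u + enorm v.
Proof.
rewrite -(@ler_pXn2r _ 2) ?nnegrE ?addr_ge0 ?enorm_ge0//.
rewrite sqrrD !enorm_sqr !dotpE (dotpC v u).
by have := CauchySchwarz_dotp u v; lra.
Qed.

Lemma enorm_distD u v w : enorm (u - w) <= enorm (u - v) + enorm (v - w).
Proof. by rewrite -{1}(subrK v u) -addrA enormD. Qed.

Lemma ler_dist_enorm u v : `|enorm u - enorm v| <= enorm (u - v).
Proof.
have := enormD (u - v) v; have := enormD (v - u) u.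
by rewrite !subrK -(enormN (v - u)) opprB ler_norml; lra.
Qed.

Lemma enorm_sqrD_le u v : enorm (u + v) ^+ 2 <= 2 * (enorm u ^+ 2 + enorm v ^+ 2).
Proof.
have := sqr_ge0 (enorm (u - v)).
by rewrite !enorm_sqr !dotpE (dotpC v u); lra.
Qed.

Lemma dotp_polarization u v :
  dotp u v = (enorm u ^+ 2 + enorm v ^+ 2 - enorm (u - v) ^+ 2) / 2.
Proof. by rewrite !enorm_sqr !dotpE (dotpC v u); field. Qed.

Lemma dotp_young c u v : 0 < c ->
  dotp u v <= enorm u ^+ 2 / (4 * c) + c * enorm v ^+ 2.
Proof.
move=> c0; have := dotp_ge0 (u - (2 * c) *: v).
rewrite !enorm_sqr !dotpE (dotpC v u) => uv_ge0.
rewrite -(ler_pM2l (mulr_gt0 (ltr0Sn R 3) c0)) mulrDr mulrCA mulfV ?mulr1; first by lra.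
by rewrite mulf_neq0// gt_eqF.
Qed.

Lemma normr_le_enorm u i : `|u ord0 i| <= enorm u.
Proof.
rewrite -(@ler_pXn2r _ 2) ?nnegrE ?enorm_ge0// real_normK ?num_real//.
rewrite enorm_sqr /dotp (bigD1 i)//= -expr2 lerDl.
by apply: sumr_ge0 => j _; rewrite -expr2 sqr_ge0.
Qed.

Lemma mx_norm_le_enorm u : `|u| <= enorm u.
Proof.
rewrite [leLHS]/Num.Def.normr /= mx_normrE; apply: bigmax_le; first exact: enorm_ge0.
by move=> -[i j] _ /=; rewrite ord1 normr_le_enorm.
Qed.

Lemma enorm_le_mx_norm u : enorm u <= n%:R * `|u|.
Proof.
apply: (@le_trans _ _ (\sum_(i < n) `|u ord0 i|)).
  rewrite {1}(row_sum_delta u).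
  elim/big_ind2 : _ => [||i _]; first by rewrite enorm0.
    by move=> u1 r1 u2 r2 le1 le2; exact: le_trans (enormD _ _) (lerD le1 le2).
  rewrite enormZ (_ : enorm _ = 1) ?mulr1//.
  by apply/eqP; rewrite -(@eqrXn2 _ 2) ?enorm_ge0// enorm_sqr dotp_delta mxE !eqxx expr1n.
rewrite mulr_natl -[X in _ *+ X]card_ord -sumr_const; apply: ler_sum => i _.
rewrite [leRHS]/Num.Def.normr /= mx_normrE.
exact: (le_bigmax _ (fun ij => `|u ij.1 ij.2|) (ord0, i)).
Qed.

Lemma enorm_lipschitz_continuous (F : 'rV[R]_n -> R) c :
  (forall u v, `|F u - F v| <= c * enorm (u - v)) -> continuous F.
Proof.
move=> lipF u; apply/(@cvgrPdist_le _ _ _ (nbhs u) (nbhs_filter u)) => e e0.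
apply/nbhs_ballP; have c0 : 0 < `|c| * n%:R + 1 by rewrite ltr_wpDl// mulr_ge0.
exists (e / (`|c| * n%:R + 1)); rewrite /= ?divr_gt0// => v.
rewrite -ball_normE /= ltr_pdivlMr// => /ltW uv_le; apply: le_trans (lipF _ _) _.
apply: (@le_trans _ _ (`|c| * (n%:R * `|u - v|))).
  apply: le_trans (ler_wpM2r (enorm_ge0 _) (ler_norm c)) _.
  by rewrite ler_wpM2l// enorm_le_mx_norm.
by apply: le_trans uv_le; rewrite (mulrC `|u - v|) mulrA ler_wpM2r// lerDl.
Qed.

End euclidean.

Definition elipschitz (R : realType) (m n : nat) (K : R) (g : 'rV[R]_m -> 'rV[R]_n) :=
  forall u v, enorm (g u - g v) <= K * enorm (u - v).

Lemma elipschitz_coord_continuous (R : realType) (m n : nat) (K : R)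
    (g : 'rV[R]_m -> 'rV[R]_n) i :
  elipschitz K g -> continuous (fun u => g u ord0 i).
Proof.
move=> lipg; apply: (@enorm_lipschitz_continuous _ _ _ K) => u v.
apply: le_trans (lipg u v).
by have := normr_le_enorm (g u - g v) i; rewrite !mxE.
Qed.

(** * Smooth functions *)

Lemma differentiable_quadratic_remainder (R : realType) (V W : normedModType R)
    (f : V -> W) (df : {linear V -> W}) (x : V) (C : R) : continuous df ->
  (forall u, `|f (u + x) - f x - df u| <= C * `|u| ^+ 2) ->
  differentiable f x /\ 'd f x = df :> (V -> W).
Proof.
move=> cdf remainder_le.
have expansion : f \o shift x = cst (f x) + df +o_ 0 id.
  apply/eqaddoP => e e0; apply/nbhs_ballP.
  have C0 : 0 < `|C| + 1 by rewrite ltr_wpDl.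
  exists (e / (`|C| + 1)); rewrite /= ?divr_gt0// => u.
  rewrite -ball_normE /= sub0r normrN ltr_pdivlMr// => /ltW ue.
  rewrite -[(_ + _) u]/(_ + _) -[(- _) u]/(- _) opprD addrA /=.
  apply: (le_trans (remainder_le u)); rewrite expr2 mulrA ler_wpM2r//.
  apply: le_trans ue; rewrite (mulrC `|u|) ler_wpM2r//.
  by apply: le_trans (ler_norm _) _; rewrite lerDl.
have dfE : 'd f x = df :> (V -> W) by exact: diff_unique.
by split => //; apply/diff_locallyP; rewrite dfE.
Qed.

Section smooth.
Context {R : realType} (n : nat).
Implicit Types (F : 'rV[R]_n -> R) (x u g : 'rV[R]_n) (C : R).

Definition smooth C F := (forall x, differentiable F x) /\ elipschitz C (gradient F).

Lemma derive_dotp F x u : differentiable F x -> 'D_u F x = dotp (gradient F x) u.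
Proof.
move=> dF; rewrite deriveE// {1}(row_sum_delta u) linear_sum.
by apply: eq_bigr => i _; rewrite linearZ mxE deriveE// mulrC.
Qed.

Lemma gradientN F x : differentiable F x -> gradient (fun z => - F z) x = - gradient F x.
Proof.
by move=> dF; apply/rowP => i; rewrite !mxE deriveN//; exact: diff_derivable.
Qed.

Lemma smoothN C F : smooth C F -> smooth C (fun z => - F z).
Proof.
move=> [dF lipF]; split=> [z|z z']; first exact: differentiableN.
by rewrite !gradientN// -opprD enormN; exact: lipF.
Qed.

Lemma is_derive_line F x u (t : R) : differentiable F (t *: u + x) ->
  is_derive t 1 (fun s => F (s *: u + x)) (dotp (gradient F (t *: u + x)) u).
Proof.
move=> dF; have quotientE :
    (fun h : R => h^-1 *: (((fun s => F (s *: u + x)) \o shift t) (h *: 1)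
                           - F (t *: u + x))) =
    (fun h : R => h^-1 *: ((F \o shift (t *: u + x)) (h *: u) - F (t *: u + x))).
  by apply/funext => h /=; rewrite -[h *: 1]/(h * 1) mulr1 scalerDl addrA.
have derivF : derivable F (t *: u + x) u by exact: diff_derivable.
split; first by rewrite /derivable quotientE; exact: derivF.
by rewrite -derive_dotp// /derive quotientE.
Qed.

Lemma smooth_ub C F x u : smooth C F ->
  F (x + u) <= F x + dotp (gradient F x) u + C / 2 * enorm u ^+ 2.
Proof.
move=> [dF lipF]; set a := dotp (gradient F x) u; set b := C / 2 * enorm u ^+ 2.
pose q (t : R) := F (t *: u + x) - (t * a + t ^+ 2 * b).
pose dq (t : R) := dotp (gradient F (t *: u + x)) u - (a + 2 * t * b).
have q_deriv (t : R) : is_derive t 1 q (dq t).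
  have line_deriv := is_derive_line (dF (t *: u + x)).
  by apply: is_derive_eq; rewrite /dq /GRing.scale/=; ring.
have dq_le0 t : 0 <= t -> dq t <= 0.
  move=> t0; have := CauchySchwarz_dotp (gradient F (t *: u + x) - gradient F x) u.
  have := lipF (t *: u + x) x; rewrite addrK enormZ ger0_norm// dotpDl dotpNl -/a.
  by move=> /(ler_wpM2r (enorm_ge0 u)); rewrite /dq /b; lra.
have [c cin q01] : exists2 c, c \in `]0%R, 1%R[ & q 1 - q 0 = dq c * (1 - 0).
  apply: MVT => //; apply: derivable_within_continuous => t _.
  by have [] := q_deriv t.
move: cin; rewrite in_itv/= => /andP[/ltW/dq_le0 dqc _].
by move: dqc q01; rewrite /q scale1r scale0r add0r (addrC u x); lra.
Qed.

Lemma smooth_lb C F x u : smooth C F ->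
  F x + dotp (gradient F x) u - C / 2 * enorm u ^+ 2 <= F (x + u).
Proof.
move=> smoothF; have := smooth_ub x u (smoothN smoothF).
by rewrite gradientN ?dotpNl; [lra|exact: smoothF.1].
Qed.

Lemma smooth_gradient_max C F x : 0 < C -> smooth C F ->
  (forall z, F z <= F x) -> gradient F x = 0.
Proof.
move=> C0 smoothF x_max; apply/eqP; rewrite -enorm_eq0 -sqrf_eq0.
have := le_trans (smooth_lb x (C^-1 *: gradient F x) smoothF) (x_max _).
rewrite dotpZr -enorm_sqr enormZ exprMn real_normK ?num_real//.
have -> : F x + C^-1 * enorm (gradient F x) ^+ 2
    - C / 2 * (C^-1 ^+ 2 * enorm (gradient F x) ^+ 2)
    = F x + (2 * C)^-1 * enorm (gradient F x) ^+ 2 by field; rewrite gt_eqF.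
by rewrite gerDl pmulr_rle0 ?invr_gt0 ?mulr_gt0// eq_le sqr_ge0 andbT.
Qed.

Lemma differentiable_dotp_remainder F x g C :
  (forall u, `|F (x + u) - F x - dotp g u| <= C * enorm u ^+ 2) ->
  differentiable F x /\ gradient F x = g.
Proof.
move=> remainder_le.
have cont_dotp : continuous (dotp g).
  apply: (@enorm_lipschitz_continuous _ _ _ (enorm g)) => u v.
  rewrite -linearB ler_norml CauchySchwarz_dotp andbT lerNl -linearN.
  by rewrite -(enormN (u - v)) CauchySchwarz_dotp.
have mx_remainder_le u :
    `|F (u + x) - F x - dotp g u| <= `|C| * n%:R ^+ 2 * `|u| ^+ 2.
  rewrite (addrC u x); apply: le_trans (remainder_le u) _.
  apply: (@le_trans _ _ (`|C| * enorm u ^+ 2)).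
    by rewrite ler_wpM2r ?sqr_ge0// ler_norm.
  rewrite -mulrA ler_wpM2l// -exprMn ler_pXn2r ?nnegrE ?enorm_ge0 ?mulr_ge0//.
  exact: enorm_le_mx_norm.
have [dF dFE] := differentiable_quadratic_remainder cont_dotp mx_remainder_le.
by split => //; apply/rowP => i; rewrite mxE deriveE// dFE; exact: dotp_delta.
Qed.

Lemma smooth_descent_step C F x w (s : R) : 0 <= s -> smooth C F ->
  F (x - s *: w) <=
    F x - s / 2 * (1 - C * s) * enorm w ^+ 2 + s / 2 * enorm (gradient F x - w) ^+ 2.
Proof.
move=> s0 /(smooth_ub x (- (s *: w))).
rewrite dotpNr dotpZr dotp_polarization enormN enormZ.
rewrite exprMn real_normK ?num_real//.
have : 0 <= s * enorm (gradient F x) ^+ 2 by rewrite mulr_ge0// sqr_ge0.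
by rewrite expr2; lra.
Qed.

End smooth.

(** * The Polyak-Lojasiewicz inequality *)

Section polyak_lojasiewicz.
Context {R : realType} (n : nat).
Implicit Types (h phi : 'rV[R]_n -> R) (y v : 'rV[R]_n) (mu L M c s : R).

Definition polyak_lojasiewicz mu M h :=
  forall y, 2 * mu * (M - h y) <= enorm (gradient h y) ^+ 2.

Lemma PL_ascent_step mu M L h y v s :
  smooth L h -> polyak_lojasiewicz mu M h -> 0 <= s -> 2 * (s * L) <= 1 ->
  M - h (y + s *: v) <= (1 - s * mu) * (M - h y) - s / 4 * enorm v ^+ 2
                        + s / 2 * enorm (gradient h y - v) ^+ 2.
Proof.
move=> smoothh PLh s0 sL; have := ler_wpM2l s0 (PLh y).
have := ler_wpM2r (mulr_ge0 s0 (sqr_ge0 (enorm v))) sL.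
have := smooth_lb y (s *: v) smoothh.
rewrite dotpZr dotp_polarization enormZ exprMn real_normK ?num_real// expr2.
by lra.
Qed.

Lemma continuous_coercive_min phi c y : 0 < c -> continuous phi ->
  (forall z, c * enorm (z - y) <= phi z) -> exists z, forall z', phi z <= phi z'.
Proof.
move=> c0 cphi coercive; pose A := [set z | phi z <= phi y].
have closedA : closed A.
  by apply: (closed_comp (D := [set r | r <= phi y])) => // z _; exact: cphi.
have boundedA : bounded_set A.
  exists (`|y| + phi y / c); split; first exact: num_real.
  move=> M /ltW ltM z /= Az; apply: le_trans ltM.
  rewrite -{1}(subrK y z) addrC; apply: le_trans (ler_normD _ _) _; rewrite lerD2l.
  apply: le_trans (mx_norm_le_enorm _) _; rewrite ler_pdivlMr// mulrC.
  exact: le_trans (coercive z) Az.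
have [|z /set_mem Az zmin] :=
    EVT_min_rV _ (bounded_closed_compact boundedA closedA) (continuous_subspaceT cphi).
  by exists y; rewrite /A /=.
exists z => z'; have [Az'|/ltW yz'] := leP (phi z') (phi y).
  by apply: zmin; rewrite inE.
exact: le_trans Az yz'.
Qed.

Section quadratic_growth.
Variables (mu M L : R) (h : 'rV[R]_n -> R).
Hypothesis L_gt0 : 0 < L.
Hypothesis smoothh : smooth L h.
Hypothesis PLh : polyak_lojasiewicz mu M h.
Hypothesis h_le : forall y, h y <= M.

Let gap_sqr y : Num.sqrt (M - h y) ^+ 2 = M - h y.
Proof. by rewrite sqr_sqrtr// subr_ge0. Qed.

Lemma PL_sqrt_gap_decrease c y : 0 < c -> c < Num.sqrt (mu / 2) -> h y < M ->
  exists v, Num.sqrt (M - h (y + v)) + c * enorm v < Num.sqrt (M - h y).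
Proof.
set r := Num.sqrt (mu / 2) => c0 cr yM; set G := enorm (gradient h y).
have r0 : 0 < r by exact: lt_trans cr.
have r_sqr : r ^+ 2 = mu / 2 by rewrite sqr_sqrtr//; move: r0; rewrite sqrtr_gt0 => /ltW.
pose s := (r - c) / (r * L); pose theta := 1 - L * s / 2.
have s0 : 0 < s by rewrite divr_gt0 ?subr_gt0 ?mulr_gt0.
have theta_r : theta * r = (r + c) / 2 by rewrite /theta /s; field; rewrite !gt_eqF.
have theta0 : 0 < theta by rewrite -(pmulr_lgt0 _ r0) theta_r divr_gt0 ?addr_gt0.
exists (s *: gradient h y); rewrite enormZ gtr0_norm// -/G.
set a := Num.sqrt (M - h y); set b := Num.sqrt _.
have a0 : 0 < a by rewrite sqrtr_gt0 subr_gt0.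
have b0 : 0 <= b by exact: sqrtr_ge0.
have ascent : b ^+ 2 <= a ^+ 2 - s * theta * G ^+ 2.
  have := smooth_lb y (s *: gradient h y) smoothh.
  rewrite dotpZr -enorm_sqr enormZ gtr0_norm// -/G /a /b !gap_sqr exprMn /theta expr2.
  by lra.
have steep : 2 * r * a <= G.
  rewrite -(@ler_pXn2r _ 2) ?nnegrE ?enorm_ge0 ?mulr_ge0 ?(ltW r0) ?(ltW a0)//.
  by rewrite !exprMn r_sqr gap_sqr; have := PLh y; rewrite -/G; lra.
have G0 : 0 < G by rewrite (lt_le_trans _ steep)// !mulr_gt0.
rewrite ltNge; apply/negP => stuck.
have ba : b <= a.
  rewrite -(@ler_pXn2r _ 2) ?nnegrE ?(ltW a0)//; apply: le_trans ascent _.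
  by rewrite gerBl mulr_ge0 ?sqr_ge0// ltW// mulr_gt0.
have : theta * r * (s * G ^+ 2) <= c * (s * G ^+ 2).
  apply: (@le_trans _ _ ((a - b) * (2 * r * a))).
    have two_a : (a - b) * (a + b) <= (a - b) * (2 * a).
      by rewrite ler_wpM2l ?subr_ge0//; lra.
    by move: (ler_wpM2l (ltW r0) two_a) (ler_wpM2l (ltW r0) ascent); lra.
  rewrite (_ : c * (s * G ^+ 2) = c * (s * G) * G); last by ring.
  by rewrite ler_pM ?subr_ge0// ?mulr_ge0 ?(ltW r0) ?(ltW a0)//; lra.
by rewrite ler_pM2r ?theta_r; [lra|exact: mulr_gt0 s0 (exprn_gt0 2 G0)].
Qed.

(* A minimiser of [sqrt (M - h) + c |. - y|] must maximise [h], as otherwise an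
   ascent step decreases this function. *)
Lemma PL_quadratic_growth c y : 0 < c -> c < Num.sqrt (mu / 2) ->
  exists ys, h ys = M /\ c * enorm (ys - y) <= Num.sqrt (M - h y).
Proof.
move=> c0 c_lt; pose phi z := Num.sqrt (M - h z) + c * enorm (z - y).
have cphi : continuous phi.
  move=> z; apply: (continuousD (f := fun z => Num.sqrt (M - h z))).
    apply: (continuous_comp (f := fun z => M - h z)); last exact: sqrt_continuous.
    apply: (continuousB (f := fun=> M)); first exact: cst_continuous.
    exact: (differentiable_continuous (smoothh.1 z)).
  apply: (@enorm_lipschitz_continuous _ _ (fun z => c * enorm (z - y)) c) => u v.
  rewrite -mulrBr normrM gtr0_norm// ler_pM2l//; apply: le_trans (ler_dist_enorm _ _) _.
  by rewrite opprB addrA subrK.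
have [|ys ys_min] := continuous_coercive_min c0 cphi (y := y).
  by move=> z; rewrite lerDr sqrtr_ge0.
have ys_le := ys_min y; rewrite /phi subrr enorm0 mulr0 addr0 in ys_le.
exists ys; split; last by apply: le_trans ys_le; rewrite lerDr sqrtr_ge0.
apply/eqP; rewrite eq_le h_le leNgt; apply/negP => /(PL_sqrt_gap_decrease c0 c_lt)[v].
apply/negP; rewrite -leNgt; have := ys_min (ys + v); rewrite /phi.
have := enormD v (ys - y); rewrite addrA (addrC v) => /(ler_wpM2l (ltW c0)).
by lra.
Qed.

End quadratic_growth.

End polyak_lojasiewicz.

(** * The value function *)

Section value_function.
Context {R : realType} (d p : nat).
Implicit Types (f : 'rV[R]_d -> 'rV[R]_p -> R) (F : 'rV[R]_d -> R).

Definition value_function f F :=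
  forall x, exists ys, (forall y, f x y <= f x ys) /\ F x = f x ys.

Record PL_saddle f F (mu Lf : R) : Prop := {
  PL_saddle_mu_gt0 : 0 < mu;
  PL_saddle_Lf_gt0 : 0 < Lf;
  PL_saddle_smoothx : forall y, smooth Lf (f ^~ y);
  PL_saddle_smoothy : forall x, smooth Lf (f x);
  PL_saddle_gradx_lip : forall x, elipschitz Lf (gradx f x);
  PL_saddle_grady_lip : forall y, elipschitz Lf (fun x => grady f x y);
  PL_saddle_value : value_function f F;
  PL_saddle_PL : forall x, polyak_lojasiewicz mu (F x) (f x) }.

Variables (f : 'rV[R]_d -> 'rV[R]_p -> R) (F : 'rV[R]_d -> R) (mu Lf : R).
Hypothesis saddle : PL_saddle f F mu Lf.

Let mu_gt0 : 0 < mu := PL_saddle_mu_gt0 saddle.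
Let Lf_gt0 : 0 < Lf := PL_saddle_Lf_gt0 saddle.

Lemma value_ge x y : f x y <= F x.
Proof. by have [ys [ys_max ->]] := PL_saddle_value saddle x. Qed.

Lemma grady_argmax x ys : F x = f x ys -> grady f x ys = 0.
Proof.
move=> Fx; apply: (smooth_gradient_max Lf_gt0 (PL_saddle_smoothy saddle x)) => y.
by rewrite -Fx value_ge.
Qed.

(* The PL inequality at the old maximiser replaces the Lipschitz continuity of
   the argmax. *)
Lemma gap_at_argmax_le x ys u : F x = f x ys ->
  F (x + u) - f (x + u) ys <= Lf ^+ 2 / (2 * mu) * enorm u ^+ 2.
Proof.
move=> Fx; rewrite mulrAC ler_pdivlMr ?mulr_gt0// mulrC.
apply: le_trans (PL_saddle_PL saddle (x + u) ys) _.
have := PL_saddle_grady_lip saddle ys (x + u) x.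
rewrite (grady_argmax Fx) subr0 (addrC x u) addrK => grad_le.
by rewrite -exprMn ler_pXn2r ?nnegrE ?enorm_ge0 ?mulr_ge0 ?enorm_ge0 // ltW.
Qed.

Lemma value_quadratic_bounds x ys u : F x = f x ys ->
  `|F (x + u) - F x - dotp (gradx f x ys) u| <= Lf * (1 + Lf / mu) / 2 * enorm u ^+ 2.
Proof.
move=> Fx; have := smooth_ub x u (PL_saddle_smoothx saddle ys).
have := smooth_lb x u (PL_saddle_smoothx saddle ys).
have := gap_at_argmax_le u Fx; have := value_ge (x + u) ys.
have -> : Lf * (1 + Lf / mu) / 2 = Lf / 2 + Lf ^+ 2 / (2 * mu) by field; rewrite gt_eqF.
have : 0 <= Lf ^+ 2 / (2 * mu) * enorm u ^+ 2.
  by rewrite mulr_ge0 ?sqr_ge0// divr_ge0 ?sqr_ge0// mulr_ge0// ltW.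
by rewrite -Fx mulrDl ler_norml /gradx; lra.
Qed.

Lemma gradient_value x ys : F x = f x ys ->
  differentiable F x /\ gradient F x = gradx f x ys.
Proof.
move=> Fx; apply: differentiable_dotp_remainder => u.
exact: value_quadratic_bounds.
Qed.

Lemma gradient_value_gap_le x y :
  enorm (gradient F x - gradx f x y) ^+ 2 <= 2 * Lf ^+ 2 / mu * (F x - f x y).
Proof.
set G := enorm _; set a := Num.sqrt (F x - f x y); set r := Num.sqrt (mu / 2).
have a_sqr : a ^+ 2 = F x - f x y by rewrite sqr_sqrtr// subr_ge0 value_ge.
have r_sqr : r ^+ 2 = mu / 2 by rewrite sqr_sqrtr// divr_ge0// ltW.
have growth c : 0 < c -> c < r -> c * G <= Lf * a.
  move=> c0 cr; have [ys [Fx ys_le]] := PL_quadratic_growth Lf_gt0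
    (PL_saddle_smoothy saddle x) (PL_saddle_PL saddle x) (value_ge x) y c0 cr.
  rewrite /G (gradient_value (esym Fx)).2.
  have := ler_wpM2l (ltW c0) (PL_saddle_gradx_lip saddle x ys y).
  by have := ler_wpM2l (ltW Lf_gt0) ys_le; rewrite -/a; lra.
have rG : r * G <= Lf * a.
  have r0 : 0 < r by rewrite sqrtr_gt0 divr_gt0.
  have [->|G0] := eqVneq G 0; first by rewrite mulr0 mulr_ge0 ?sqrtr_ge0 ?(ltW Lf_gt0).
  have {}G0 : 0 < G by rewrite lt_def G0 enorm_ge0.
  rewrite -ler_pdivlMr// leNgt; apply/negP => /midf_lt[lt_c c_lt].
  have c0 : 0 < (Lf * a / G + r) / 2.
    by apply: le_lt_trans lt_c; rewrite divr_ge0 ?mulr_ge0 ?sqrtr_ge0 ?ltW.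
  by have := growth _ c0 c_lt; rewrite -ler_pdivlMr// leNgt lt_c.
have : (r * G) ^+ 2 <= (Lf * a) ^+ 2.
  by rewrite ler_pXn2r ?nnegrE ?mulr_ge0 ?sqrtr_ge0 ?enorm_ge0// ltW.
rewrite !exprMn a_sqr r_sqr mulrAC => rG_sqr.
by rewrite [leRHS]mulrAC ler_pdivlMr//; lra.
Qed.

Lemma smooth_value : smooth (Lf * (1 + Lf / mu)) F.
Proof.
split=> [x|x' x]; first by have [ys [_ /gradient_value[]]] := PL_saddle_value saddle x.
have [ys [_ Fx]] := PL_saddle_value saddle x; rewrite (gradient_value Fx).2.
apply: le_trans (enorm_distD _ (gradx f x' ys) _) _.
rewrite mulrDr mulr1 mulrDl addrC lerD//; first exact: (PL_saddle_smoothx saddle ys).2.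
have kappa0 : 0 <= Lf * (Lf / mu) by rewrite mulr_ge0 ?divr_ge0// ltW.
rewrite -(@ler_pXn2r _ 2) ?nnegrE ?enorm_ge0 ?(mulr_ge0 kappa0) ?enorm_ge0//.
apply: le_trans (gradient_value_gap_le _ _) _.
have := gap_at_argmax_le (x' - x) Fx; rewrite (addrC x) subrK.
have c0 : 0 <= 2 * Lf ^+ 2 / mu by rewrite divr_ge0 ?(ltW mu_gt0)// mulr_ge0// sqr_ge0.
move=> /(ler_wpM2l c0) gap_le; apply: le_trans gap_le _.
by rewrite le_eqVlt; apply/orP; left; apply/eqP; field; rewrite gt_eqF.
Qed.

End value_function.

(** * One step of the recursion *)

Record admissible_steps (R : realType) (mu Lf lam gam : R) : Prop := {
  admissible_lam_gt0 : 0 < lam;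
  admissible_gam_gt0 : 0 < gam;
  admissible_lam_le : 32 * (lam * mu) ^+ 2 <= 9;
  admissible_gam_le : 8 * gam * (Lf * (2 + Lf / mu)) <= lam * mu }.

(* Contracting the gap by [eta * lam * mu / 3] with this weight pays for the gap
   terms of [value_descent] and of [sqr_metric]. *)
Definition gap_weight (R : realType) (mu Lf lam gam : R) : R :=
  9 * gam * Lf ^+ 2 / (lam * mu ^+ 2).

Section admissible_bounds.
Context {R : realType}.
Variables (mu Lf lam gam : R).
Hypotheses (mu_gt0 : 0 < mu) (Lf_gt0 : 0 < Lf).
Hypothesis steps : admissible_steps mu Lf lam gam.

Let lam_gt0 : 0 < lam := admissible_lam_gt0 steps.
Let gam_gt0 : 0 < gam := admissible_gam_gt0 steps.

Lemma gap_weight_gt0 : 0 < gap_weight mu Lf lam gam.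
Proof. by rewrite divr_gt0 ?mulr_gt0 ?exprn_gt0. Qed.

Lemma lam_mu_le : lam * mu <= 9 / 16.
Proof.
have rho0 : 0 < lam * mu by rewrite mulr_gt0.
have sqrE : (9 / 16) ^+ 2 = 81 / 256 :> R by field.
rewrite -(@ler_pXn2r _ 2) ?nnegrE ?(ltW rho0)// sqrE.
by have := admissible_lam_le steps; lra.
Qed.

Let gam_split_le : 16 * (gam * Lf) + 8 * (gam * (Lf ^+ 2 / mu)) <= lam * mu.
Proof.
apply: le_trans (admissible_gam_le steps); rewrite le_eqVlt; apply/orP; left; apply/eqP.
by field; rewrite gt_eqF.
Qed.

Lemma gam_sqr_Lf_le : 8 * (gam * (Lf ^+ 2 / mu)) <= lam * mu.
Proof. by have := mulr_gt0 gam_gt0 Lf_gt0; move: gam_split_le; lra. Qed.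

Lemma gam_Lf_le : gam * Lf <= 9 / 256.
Proof.
have : 0 <= gam * (Lf ^+ 2 / mu) by rewrite mulr_ge0 ?divr_ge0 ?sqr_ge0 ?ltW.
by move: lam_mu_le gam_split_le; lra.
Qed.

Lemma lam_gam_sqr_Lf_le : lam * gam * Lf ^+ 2 <= 9 / 256.
Proof.
have := ler_wpM2l (ltW (mulr_gt0 lam_gt0 mu_gt0)) gam_sqr_Lf_le.
have -> : lam * mu * (8 * (gam * (Lf ^+ 2 / mu))) = 8 * (lam * gam * Lf ^+ 2).
  by field; rewrite gt_eqF.
by have := admissible_lam_le steps; lra.
Qed.

Lemma gap_weight_le : gap_weight mu Lf lam gam <= 9 / 8.
Proof.
rewrite ler_pdivrMr ?mulr_gt0 ?exprn_gt0//.
have := ler_wpM2r (ltW mu_gt0) gam_sqr_Lf_le.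
have -> : 8 * (gam * (Lf ^+ 2 / mu)) * mu = 8 * gam * Lf ^+ 2 by field; rewrite gt_eqF.
by rewrite expr2; lra.
Qed.

Lemma gam_curvature_le : gam * (Lf * (2 + Lf / mu)) <= 9 / 128.
Proof. by have := admissible_gam_le steps; have := lam_mu_le; lra. Qed.

End admissible_bounds.

Definition momentum_mse (R : realType) (b variance sqr_increment sqr_err : R) : R :=
  (1 - b) ^+ 2 * sqr_err + 2 * b ^+ 2 * variance + 2 * (1 - b) ^+ 2 * sqr_increment.

Definition admissible_momentum (R : realType) (q c etaP eta : R) : Prop :=
  0 <= c * eta ^+ 2 <= 1 /\ eta^-1 - etaP^-1 <= (c - q) * eta.

Lemma momentum_mse_decay (R : realType) (gam eta etaP c q sg incr err : R) :
  0 < gam -> 0 < eta -> 0 <= incr -> 0 <= err -> admissible_momentum q c etaP eta ->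
  gam / eta * momentum_mse (c * eta ^+ 2) sg incr err + gam * q * eta * err
  <= gam / etaP * err + 2 * gam * c ^+ 2 * eta ^+ 3 * sg + 2 * gam / eta * incr.
Proof.
move=> gam0 eta0 incr0 err0 [/andP[b0 b1] drift]; set b := c * eta ^+ 2 in b0 b1 *.
have ratio0 : 0 <= gam / eta by rewrite divr_ge0// ltW.
have b_sqr : (1 - b) ^+ 2 <= 1 - b by rewrite expr2 ler_piMr; lra.
have err_le : gam / eta * ((1 - b) ^+ 2 * err)
    <= gam * err * eta^-1 - gam * err * (c * eta).
  have -> : gam * err * eta^-1 - gam * err * (c * eta) = gam / eta * ((1 - b) * err).
    by rewrite /b; field; rewrite gt_eqF.
  by rewrite ler_wpM2l// ler_wpM2r.
have incr_le : gam / eta * (2 * (1 - b) ^+ 2 * incr) <= 2 * gam / eta * incr.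
  rewrite (_ : gam / eta * _ = 2 * gam / eta * incr * (1 - b) ^+ 2); last by ring.
  by rewrite ler_piMr//; [rewrite mulr_ge0// -mulrA mulr_ge0|lra].
have sgE : gam / eta * (2 * b ^+ 2 * sg) = 2 * gam * c ^+ 2 * eta ^+ 3 * sg.
  by rewrite /b; field; rewrite gt_eqF.
have := ler_wpM2l (mulr_ge0 (ltW gam0) err0) drift.
by rewrite /momentum_mse !(mulrDr (gam / eta)) sgE; move: err_le incr_le; lra.
Qed.

Definition sqr_metric (R : realType) (d p : nat) (f : 'rV[R]_d -> 'rV[R]_p -> R) F
    (mu Lf : R) x y w : R :=
  enorm w ^+ 2 + 2 * Lf ^+ 2 / mu * (F x - f x y) + enorm (gradx f x y - w) ^+ 2.

Section descent.
Context {R : realType} (d p : nat).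
Variables (f : 'rV[R]_d -> 'rV[R]_p -> R) (F : 'rV[R]_d -> R) (mu Lf lam gam eta : R).
Hypothesis saddle : PL_saddle f F mu Lf.
Hypothesis steps : admissible_steps mu Lf lam gam.
Hypothesis eta01 : 0 < eta <= 1.
Hypothesis eta_lam : 2 * (eta * lam * Lf) <= 1.
Variables (x w : 'rV[R]_d) (y v : 'rV[R]_p).

Local Notation x' := (x - (eta * gam) *: w).
Local Notation y' := (y + (eta * lam) *: v).
Local Notation gap := (F x - f x y).
Local Notation weight := (gap_weight mu Lf lam gam).

Let mu_gt0 : 0 < mu := PL_saddle_mu_gt0 saddle.
Let Lf_gt0 : 0 < Lf := PL_saddle_Lf_gt0 saddle.
Let lam_gt0 : 0 < lam := admissible_lam_gt0 steps.
Let gam_gt0 : 0 < gam := admissible_gam_gt0 steps.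
Let eta_gt0 : 0 < eta. Proof. by case/andP: eta01. Qed.
Let eta_le1 : eta <= 1. Proof. by case/andP: eta01. Qed.
Let eta_gam_gt0 : 0 < eta * gam. Proof. exact: mulr_gt0. Qed.
Let eta_lam_gt0 : 0 < eta * lam. Proof. exact: mulr_gt0. Qed.

Let gap_ge0 : 0 <= gap. Proof. by rewrite subr_ge0 (value_ge saddle). Qed.

Let step_sqr_ge0 : 0 <= eta * gam * enorm w ^+ 2.
Proof. by rewrite mulr_ge0 ?sqr_ge0 ?ltW. Qed.

Let curvature_le : Lf * (2 + Lf / mu) * (eta * gam) <= 9 / 128.
Proof.
apply: le_trans (gam_curvature_le mu_gt0 steps).
rewrite mulrCA (mulrC _ gam) ler_piMl// mulr_ge0 ?(ltW gam_gt0)// mulr_ge0 ?(ltW Lf_gt0)//.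
by rewrite addr_ge0// divr_ge0// ltW.
Qed.

Lemma value_descent :
  F x' <= F x + eta * gam * (2 * Lf ^+ 2 / mu * gap + enorm (gradx f x y - w) ^+ 2)
          - 9 / 20 * (eta * gam) * enorm w ^+ 2.
Proof.
have := smooth_descent_step x w (ltW eta_gam_gt0) (smooth_value saddle).
have := enorm_sqrD_le (gradient F x - gradx f x y) (gradx f x y - w); rewrite addrA subrK.
have := gradient_value_gap_le saddle x y.
have : Lf * (1 + Lf / mu) * (eta * gam) <= 9 / 128.
  by have := mulr_gt0 Lf_gt0 eta_gam_gt0; move: curvature_le; lra.
move=> /(ler_wpM2r step_sqr_ge0) curv /(ler_wpM2l (ltW eta_gam_gt0)) grad_le.
by move=> /(ler_wpM2l (ltW eta_gam_gt0)); move: curv grad_le step_sqr_ge0; lra.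
Qed.

Lemma gap_descent_x :
  F x' - f x' y <=
    (1 + 2 / 3 * (eta * lam * mu)) * gap + 13 / 100 * (eta * gam) * enorm w ^+ 2.
Proof.
have weight0 := gap_weight_gt0 mu_gt0 Lf_gt0 steps.
have := dotp_young (gradx f x y - gradient F x) w (divr_gt0 weight0 (ltr0Sn R 11)).
have := smooth_ub x (- ((eta * gam) *: w)) (smooth_value saddle).
have := smooth_lb x (- ((eta * gam) *: w)) (PL_saddle_smoothx saddle y).
rewrite !dotpNr !dotpZr dotpDl dotpNl enormN enormZ exprMn real_normK ?num_real//.
rewrite -(enormN (_ - gradient F x)) opprB -/(gradx f x y).
set N := enorm _ ^+ 2 => f_lb F_ub /(ler_wpM2l (ltW eta_gam_gt0)) young.
have N_le : eta * gam * (N / (4 * (weight / 12))) <= 2 / 3 * (eta * lam * mu) * gap.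
  have -> : eta * gam * (N / (4 * (weight / 12)))
      = (2 * Lf ^+ 2 / mu)^-1 * (2 / 3 * (eta * lam * mu)) * N.
    by rewrite /gap_weight; field; rewrite !gt_eqF.
  have coef_ge0 : 0 <= 2 / 3 * (eta * lam * mu).
    by rewrite mulr_ge0// mulr_ge0 ?(ltW mu_gt0)// ltW.
  rewrite mulrAC mulrC ler_wpM2l//.
  rewrite mulrC ler_pdivrMr ?divr_gt0 ?mulr_gt0 ?exprn_gt0// mulrC.
  exact: (gradient_value_gap_le saddle).
have := ler_wpM2r step_sqr_ge0 (gap_weight_le mu_gt0 Lf_gt0 steps).
have := ler_wpM2r step_sqr_ge0 curvature_le; move: f_lb F_ub young N_le; rewrite mulrDr.
by move: step_sqr_ge0; clearbody N; lra.
Qed.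

Let grady_shift_le : eta * lam * enorm (grady f x' y - grady f x y) ^+ 2
  <= 9 / 256 * (eta * gam * enorm w ^+ 2).
Proof.
have shift0 : 0 <= Lf * enorm ((eta * gam) *: w) by rewrite mulr_ge0 ?enorm_ge0// ltW.
have := PL_saddle_grady_lip saddle y x' x; rewrite (addrC x) addrK enormN.
rewrite -(@ler_pXn2r _ 2) ?nnegrE ?enorm_ge0// => /(ler_wpM2l (ltW eta_lam_gt0)) lip.
apply: le_trans lip _; rewrite enormZ gtr0_norm// !exprMn.
apply: le_trans (ler_wpM2r step_sqr_ge0 (lam_gam_sqr_Lf_le mu_gt0 Lf_gt0 steps)).
rewrite (_ : eta * lam * _ = eta ^+ 2 * (lam * gam * Lf ^+ 2 * (eta * gam * enorm w ^+ 2))).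
  by rewrite ler_piMl ?expr_le1 ?(ltW eta_gt0)// mulr_ge0// !mulr_ge0 ?sqr_ge0// ltW.
by ring.
Qed.

Lemma gap_descent :
  F x' - f x' y' <= (1 - eta * lam * mu / 3) * gap + eta * gam / 6 * enorm w ^+ 2
                    - eta * lam / 4 * enorm v ^+ 2
                    + eta * lam * enorm (grady f x y - v) ^+ 2.
Proof.
have rho_le1 : eta * lam * mu <= 1.
  have := lam_mu_le mu_gt0 steps; rewrite -mulrA => lam_mu.
  by apply: (mulr_ile1 (ltW eta_gt0) _ eta_le1); [rewrite ltW// mulr_gt0|lra].
have rho_ge0 : 0 <= eta * lam * mu by rewrite ltW// mulr_gt0.
have := PL_ascent_step y v (PL_saddle_smoothy saddle x') (PL_saddle_PL saddle x')
  (ltW eta_lam_gt0) eta_lam.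
have := enorm_sqrD_le (grady f x' y - grady f x y) (grady f x y - v); rewrite addrA subrK.
move=> /(ler_wpM2l (ltW eta_lam_gt0)) err_le step.
have : (1 - eta * lam * mu) * (F x' - f x' y)
    <= (1 - eta * lam * mu / 3) * gap + 13 / 100 * (eta * gam * enorm w ^+ 2).
  have o0 : 0 <= 1 - eta * lam * mu by rewrite subr_ge0.
  apply: le_trans (ler_wpM2l o0 gap_descent_x) _.
  have := mulr_ge0 rho_ge0 (mulr_ge0 rho_ge0 gap_ge0).
  by have := mulr_ge0 rho_ge0 step_sqr_ge0; move: step_sqr_ge0; lra.
by move: err_le step grady_shift_le step_sqr_ge0; rewrite -/(grady f x' y); lra.
Qed.

Lemma descent_step :
  F x' + weight * (F x' - f x' y')
    + gam * eta / 4 * (enorm w ^+ 2 + 2 * Lf ^+ 2 / mu * gap)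
    + 8 * gam * Lf ^+ 2 * eta * (gam ^+ 2 * enorm w ^+ 2 + lam ^+ 2 * enorm v ^+ 2)
  <= F x + weight * gap + gam * eta * enorm (gradx f x y - w) ^+ 2
     + weight * (eta * lam) * enorm (grady f x y - v) ^+ 2.
Proof.
have weight0 := gap_weight_gt0 mu_gt0 Lf_gt0 steps.
have weight_W : weight * (eta * gam / 6 * enorm w ^+ 2)
    <= 3 / 16 * (eta * gam * enorm w ^+ 2).
  by have := ler_wpM2r step_sqr_ge0 (gap_weight_le mu_gt0 Lf_gt0 steps); lra.
have gam2_W : 8 * gam * Lf ^+ 2 * eta * (gam ^+ 2 * enorm w ^+ 2)
    <= 1 / 80 * (eta * gam * enorm w ^+ 2).
  have gL0 : 0 <= gam * Lf by rewrite ltW// mulr_gt0.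
  have gL_le := gam_Lf_le mu_gt0 steps.
  by have := ler_wpM2r step_sqr_ge0 (ler_pM gL0 gL0 gL_le gL_le); move: step_sqr_ge0; lra.
have V_le : 8 * gam * Lf ^+ 2 * eta * (lam ^+ 2 * enorm v ^+ 2)
    <= weight * (eta * lam / 4 * enorm v ^+ 2).
  have -> : weight * (eta * lam / 4 * enorm v ^+ 2)
      = 9 * (gam * Lf ^+ 2 * eta / (4 * mu ^+ 2) * enorm v ^+ 2).
    by rewrite /gap_weight; field; rewrite !gt_eqF.
  have -> : 8 * gam * Lf ^+ 2 * eta * (lam ^+ 2 * enorm v ^+ 2)
      = 32 * (lam * mu) ^+ 2 * (gam * Lf ^+ 2 * eta / (4 * mu ^+ 2) * enorm v ^+ 2).
    by field; rewrite gt_eqF.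
  rewrite ler_wpM2r ?(admissible_lam_le steps)//.
  by rewrite mulr_ge0 ?sqr_ge0// divr_ge0 ?mulr_ge0 ?sqr_ge0 ?ltW.
have weight_gap : weight * ((1 - eta * lam * mu / 3) * gap)
    = weight * gap - 3 * (gam * eta * (Lf ^+ 2 / mu) * gap).
  by rewrite /gap_weight; field; rewrite !gt_eqF.
have gap0 : 0 <= gam * eta * (Lf ^+ 2 / mu) * gap.
  by rewrite mulr_ge0// mulr_ge0 ?divr_ge0 ?mulr_ge0 ?sqr_ge0 ?ltW.
have := ler_wpM2l (ltW weight0) gap_descent; have := value_descent.
rewrite !(mulrDr weight) mulrBr weight_gap.
by move: weight_W gam2_W V_le gap0 step_sqr_ge0; lra.
Qed.

Local Notation gx_err := (enorm (gradx f x y - w) ^+ 2).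
Local Notation gy_err := (enorm (grady f x y - v) ^+ 2).
Local Notation increment := (2 * Lf ^+ 2 * (enorm (x' - x) ^+ 2 + enorm (y' - y) ^+ 2)).

Lemma lyapunov_step etaP c1 c2 sg :
  admissible_momentum (9 * Lf ^+ 2 / mu ^+ 2) c1 etaP eta ->
  admissible_momentum (9 / 4) c2 etaP eta ->
  F x' + weight * (F x' - f x' y')
    + gam / eta * (momentum_mse (c1 * eta ^+ 2) sg increment gy_err
                   + momentum_mse (c2 * eta ^+ 2) sg increment gx_err)
    + gam * eta / 4 * sqr_metric f F mu Lf x y w
  <= F x + weight * gap + gam / etaP * (gy_err + gx_err)
     + 2 * gam * (c1 ^+ 2 + c2 ^+ 2) * eta ^+ 3 * sg.
Proof.
move=> admy admx; have gx0 := sqr_ge0 (enorm (gradx f x y - w)).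
have gy0 := sqr_ge0 (enorm (grady f x y - v)).
have increment0 : 0 <= increment.
  by apply: mulr_ge0; [rewrite mulr_ge0 ?sqr_ge0|rewrite addr_ge0 ?sqr_ge0].
have := momentum_mse_decay sg gam_gt0 eta_gt0 increment0 gx0 admx.
have := momentum_mse_decay sg gam_gt0 eta_gt0 increment0 gy0 admy.
have incrementE : 2 * gam / eta * increment = 4 * gam * Lf ^+ 2 * eta
    * (gam ^+ 2 * enorm w ^+ 2 + lam ^+ 2 * enorm v ^+ 2).
  rewrite (addrC x) (addrC y) !addrK enormN !enormZ !gtr0_norm//.
  by field; rewrite gt_eqF.
have gyE : gam * (9 * Lf ^+ 2 / mu ^+ 2) * eta * gy_err = weight * (eta * lam) * gy_err.
  by rewrite /gap_weight; field; rewrite !gt_eqF.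
rewrite incrementE gyE; have := mulr_ge0 (ltW (mulr_gt0 gam_gt0 eta_gt0)) gx0.
have := descent_step.
by rewrite /sqr_metric !(mulrDr (gam / eta)) !(mulrDr (gam / etaP)); lra.
Qed.

End descent.

(** * Measurable random vectors *)

Section caratheodory.
Context {R : realType} (dT : measure_display) (T : measurableType dT) (n : nat).

Definition grid (N : nat) (z : 'rV[R]_n) : 'rV[int]_n :=
  \row_i Num.floor (z ord0 i * N.+1%:R).

Definition ungrid (N : nat) (k : 'rV[int]_n) : 'rV[R]_n :=
  \row_i ((k ord0 i)%:~R / N.+1%:R).

Lemma mx_norm_grid_le (z : 'rV[R]_n) N : `|z - ungrid N (grid N z)| <= N.+1%:R^-1.
Proof.
rewrite [leLHS]/Num.Def.normr /= mx_normrE; apply: bigmax_le => // -[i j] _ /=.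
rewrite ord1 !mxE; set a := z ord0 j; have N0 : (0 : R) < N.+1%:R by rewrite ltr0n.
have -> : a - (Num.floor (a * N.+1%:R))%:~R / N.+1%:R =
    (a * N.+1%:R - (Num.floor (a * N.+1%:R))%:~R) / N.+1%:R.
  by rewrite mulrBl mulfK// gt_eqF.
rewrite normrM normfV (gtr0_norm N0) -[leRHS]mul1r ler_wpM2r ?invr_ge0 ?(ltW N0)//.
by have /andP[] := floor_itv (a * N.+1%:R); rewrite intrD ler_norml; lra.
Qed.

Lemma cvg_grid (z : 'rV[R]_n) : (fun N => ungrid N (grid N z)) @ \oo --> z.
Proof.
apply/cvgrPdist_le => e e0; have /cvgrPdist_le/(_ e e0) := @cvg_harmonic R.
apply: filterS => N; rewrite sub0r normrN => harmonic_le.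
apply: le_trans (mx_norm_grid_le z N) _; apply: le_trans harmonic_le.
by rewrite /harmonic ler_norm.
Qed.

Definition row_measurable (z : T -> 'rV[R]_n) :=
  forall i, measurable_fun setT (fun t => z t ord0 i).

Lemma measurable_grid_preimage (z : T -> 'rV[R]_n) N k :
  row_measurable z -> measurable [set t | grid N (z t) = k].
Proof.
move=> mz; have -> : [set t | grid N (z t) = k] = \bigcap_(i in [set: 'I_n])
    ((fun t => z t ord0 i * N.+1%:R) @^-1` `[(k ord0 i)%:~R, (k ord0 i + 1)%:~R[).
  apply/seteqP; split => [t /= <- i _ /=|t /= in_itvs].
    by rewrite in_itv /= mxE floor_itv.
  apply/rowP => i; rewrite mxE; apply/eqP; rewrite floor_eq.
  by have := in_itvs i I; rewrite /= in_itv.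
apply: fin_bigcap_measurable => [|i _]; first exact: finite_finset.
by rewrite -[X in measurable X]setTI; exact: measurable_funM.
Qed.

(* [h t (z t)] is the limit of [h t] at grid roundings of [z t], which take
   countably many values. *)
Lemma measurable_caratheodory (h : T -> 'rV[R]_n -> R) (z : T -> 'rV[R]_n) :
  (forall q, measurable_fun setT (h ^~ q)) -> (forall t, continuous (h t)) ->
  row_measurable z -> measurable_fun setT (fun t => h t (z t)).
Proof.
move=> mh ch mz.
pose rounded N t := h t (ungrid N (grid N (z t))).
apply: (@measurable_fun_cvg _ _ R setT rounded) => [N|t _]; last first.
  by apply: continuous_cvg; [exact: ch|exact: cvg_grid].
move=> _ A mA; rewrite setTI.
have -> : rounded N @^-1` A =
    \bigcup_(k : 'rV[int]_n) ([set t | grid N (z t) = k] `&` (h ^~ (ungrid N k)) @^-1` A).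
  apply/seteqP; split => [t /= At|t [k _ [/= <- //]]].
  by exists (grid N (z t)).
apply: countable_bigcupT_measurable => [|k]; first exact: countableP.
apply: measurableI; first exact: measurable_grid_preimage.
by rewrite -[X in measurable X]setTI; exact: mh.
Qed.

End caratheodory.

Section row_measurable.
Context {R : realType} (dT : measure_display) (T : measurableType dT) (n : nat).
Implicit Types (X Y : T -> 'rV[R]_n).

Lemma row_measurable_cst (u : 'rV[R]_n) : row_measurable (fun _ : T => u).
Proof. by move=> i; exact: measurable_cst. Qed.

Lemma row_measurableD X Y :
  row_measurable X -> row_measurable Y -> row_measurable (fun t => X t + Y t).
Proof. by move=> mX mY i; under eq_fun do rewrite mxE; exact: measurable_funD. Qed.

Lemma row_measurableB X Y :
  row_measurable X -> row_measurable Y -> row_measurable (fun t => X t - Y t).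
Proof. by move=> mX mY i; under eq_fun do rewrite !mxE; exact: measurable_funB. Qed.

Lemma row_measurableZ (a : R) X : row_measurable X -> row_measurable (fun t => a *: X t).
Proof. by move=> mX i; under eq_fun do rewrite mxE; exact: measurable_funM. Qed.

Lemma measurable_enorm X : row_measurable X -> measurable_fun setT (fun t => enorm (X t)).
Proof.
move=> mX; apply: (measurable_caratheodory (h := fun _ u => enorm u)) => // _.
by apply: (@enorm_lipschitz_continuous _ _ _ 1) => u v; rewrite mul1r ler_dist_enorm.
Qed.

Lemma measurable_enorm_sqr X :
  row_measurable X -> measurable_fun setT (fun t => enorm (X t) ^+ 2).
Proof. by move=> mX; apply: measurable_funX; exact: measurable_enorm. Qed.

Lemma row_measurable_comp dU (U : measurableType dU) (phi : U -> T) X :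
  measurable_fun setT phi -> row_measurable X -> row_measurable (fun u => X (phi u)).
Proof. by move=> mphi mX i; exact: (measurableT_comp (mX i) mphi). Qed.

End row_measurable.

Lemma measurable_sqrtr (R : realType) (dT : measure_display) (T : measurableType dT)
    (X : T -> R) :
  measurable_fun setT X -> measurable_fun setT (fun t => Num.sqrt (X t)).
Proof.
move=> mX; apply: (measurableT_comp (f := @Num.sqrt R)) => //.
by apply: continuous_measurable_fun; exact: sqrt_continuous.
Qed.

(** * The past of an i.i.d. sequence *)

Section past.
Context {R : realType} (dO dX : measure_display) (Omega : measurableType dO)
  (Xi : measurableType dX).
Variables (P : probability Omega R) (D : probability Xi R) (xi : nat -> Omega -> Xi).
Hypothesis iid : iid_samples P D xi.

Definition cylinder (t : nat) : set (set Omega) :=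
  [set C | exists2 A : nat -> set Xi, forall i, measurable (A i) &
    C = \bigcap_(i in [set i | (0 < i <= t)%N]) (xi i @^-1` A i)].

Definition past (t : nat) := g_sigma_algebraType (cylinder t).

Lemma measurable_sample t : measurable_fun setT (xi t).
Proof. by case: iid => mxi _; exact: mxi. Qed.

Lemma measurable_sample_preimage t B : measurable B -> measurable (xi t @^-1` B).
Proof. by move=> mB; rewrite -[X in measurable X]setTI; exact: measurable_sample. Qed.

Lemma cylinder_measurable t : cylinder t `<=` measurable.
Proof.
move=> _ [A mA ->]; apply: bigcap_measurableType => i _.
exact: measurable_sample_preimage.
Qed.

Lemma cylinder_setI t : setI_closed (cylinder t).
Proof.
move=> _ _ [A mA ->] [B mB ->]; exists (fun i => A i `&` B i); last by rewrite -bigcapI.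
by move=> i; exact: measurableI.
Qed.

Lemma cylinder_setT t : cylinder t setT.
Proof. by exists (fun=> setT) => //; apply/seteqP; split => // o _ i _. Qed.

Lemma past_measurable t (A : set Omega) : (@measurable _ (past t)) A -> measurable A.
Proof.
move: A; apply: smallest_sub; first exact: sigma_algebra_measurable.
exact: cylinder_measurable.
Qed.

Lemma measurable_fun_past t : measurable_fun setT (id : Omega -> past t).
Proof. by move=> _ A mA; rewrite setTI; exact: (@past_measurable t A mA). Qed.

Lemma row_measurable_past n t (X : Omega -> 'rV[R]_n) :
  @row_measurable _ _ (past t) _ X -> row_measurable X.
Proof. exact: (row_measurable_comp (@measurable_fun_past t)). Qed.

Lemma measurable_sample_past i t : (0 < i <= t)%N ->
  measurable_fun setT (xi i : past t -> Xi).
Proof.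
move=> it _ B mB; rewrite setTI; apply: sub_sigma_algebra.
exists (fun j => if j == i then B else setT) => [j|]; first by case: ifP.
apply/seteqP; split => [w /= Bw j _ /=|w /(_ i it)]; last by rewrite eqxx.
by case: eqP => [->|].
Qed.

Local Open Scope ereal_scope.

Lemma indep_cylinder t (A : nat -> set Xi) (B : set Xi) :
  (forall i, measurable (A i)) -> measurable B ->
  P ((\bigcap_(i in [set i | (0 < i <= t)%N]) (xi i @^-1` A i)) `&` xi t.+1 @^-1` B) =
  P (\bigcap_(i in [set i | (0 < i <= t)%N]) (xi i @^-1` A i)) * D B.
Proof.
move=> mA mB; have [_ P_cylinder] := iid; pose A' j := if j == t.+1 then B else A j.
have mA' j : measurable (A' j) by rewrite /A'; case: ifP.
have := P_cylinder t.+1 A' mA'; rewrite (P_cylinder t A mA) big_nat_recr//= {3}/A' eqxx.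
have -> : \prod_(1 <= i < t.+1) D (A' i) = \prod_(1 <= i < t.+1) D (A i).
  by apply: eq_big_nat => i /andP[_ it]; rewrite /A' (ltn_eqF it).
move=> <-; congr (P _); apply/seteqP; split => [w [/= A_w B_w] i /= /andP[i0 it]|w /= A'_w].
  rewrite /A'; case: eqVneq => [->//|it'].
  by apply: A_w; rewrite /= i0 -ltnS ltn_neqAle it' it.
split => [i /= /andP[i0 it]|].
  by have := A'_w i; rewrite /A' /= i0 (leqW it) (@ltn_eqF i)// => /(_ isT).
by have := A'_w t.+1; rewrite /A' /= leqnn eqxx => /(_ isT).
Qed.

Lemma indep_past t (A : set Omega) (B : set Xi) :
  (@measurable _ (past t)) A -> measurable B -> P (A `&` xi t.+1 @^-1` B) = P A * D B.
Proof.
move=> mA mB; have mxB := measurable_sample_preimage t.+1 mB.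
have DB_fin : D B \is a fin_num by exact: fin_num_measure.
have DB_ge0 : (0 <= fine (D B))%R by exact: fine_ge0.
pose restricted := mrestr P mxB; pose scaled := mscale (NngNum DB_ge0) P.
suff : restricted A = scaled A.
  by rewrite /restricted /scaled /mrestr /mscale /= fineK// muleC.
apply: (@g_sigma_algebra_measure_unique _ R Omega (cylinder t) (@cylinder_measurable t)
  (fun=> setT)) => //.
- by move=> _; exact: cylinder_setT.
- by rewrite bigcup_const.
- exact: cylinder_setI.
- move=> _ [C mC ->].
  rewrite -[LHS]/(P (_ `&` _)) -[RHS]/((fine (D B))%:E * P _) fineK// muleC.
  exact: indep_cylinder.
- move=> _; rewrite -[X in X < _]/(P (_ `&` _)) setTI.
  by apply: le_lt_trans (probability_le1 _ _) (ltry _).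
Qed.

Lemma tonelli_past t (h : past t * Xi -> \bar R) :
  measurable_fun setT h -> (forall z, 0 <= h z) ->
  \int[P]_o h (o, xi t.+1 o) = \int[P]_o \int[D]_s h (o, s).
Proof.
move=> mh h0; pose id_mfun := isMeasurableFun.Build _ _ _ _ _ (@measurable_fun_past t).
pose to_past : {mfun Omega >-> past t} := HB.pack (id : Omega -> past t) id_mfun.
have m_pair : @measurable_fun _ _ Omega (past t * Xi)%type setT (fun o => (o, xi t.+1 o)).
  exact: (measurable_fun_pair (@measurable_fun_past t) (measurable_sample t.+1)).
pose pair_mfun := isMeasurableFun.Build _ _ _ _ _ m_pair.
pose pair_next : {mfun Omega >-> (past t * Xi)%type} :=
  HB.pack ((fun o => (o, xi t.+1 o)) : Omega -> past t * Xi) pair_mfun.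
transitivity (\int[distribution P pair_next]_z h z).
  by rewrite ge0_integral_distribution.
transitivity (\int[distribution P to_past \x D]_z h z).
  apply: eq_measure_integral => A mA _; apply/esym.
  by apply: product_measure_unique => // B C mB mC; exact: (@indep_past t B C mB mC).
rewrite fubini_tonelli1// ge0_integral_distribution//.
  exact: measurable_fun_fubini_tonelli_F.
by move=> o; apply: integral_ge0 => s _.
Qed.

Lemma measurable_integral_sample t (h : past t * Xi -> \bar R) :
  measurable_fun setT h -> (forall z, 0 <= h z) ->
  measurable_fun (setT : set Omega) (fun o => \int[D]_s h (o, s)).
Proof.
move=> mh h0 _ A mA; have := measurable_fun_fubini_tonelli_F h mh h0 measurableT A mA.
by move=> /(_ D) mF; have := @past_measurable t _ mF; rewrite !setTI.
Qed.

Lemma ge0_integral_sample t (q : Xi -> \bar R) : (0 < t)%N ->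
  measurable_fun setT q -> (forall s, 0 <= q s) -> \int[P]_o q (xi t o) = \int[D]_s q s.
Proof.
case: t => // t _ mq q0.
have mh : measurable_fun setT (fun z : past t * Xi => q z.2).
  exact: (measurableT_comp mq measurable_snd).
rewrite (tonelli_past mh) => [|z]; last exact: q0.
by rewrite -[LHS]/(\int[P]_o cst (\int[D]_s q s) o) integral_cst//= probability_setT mule1.
Qed.

End past.

(** * Stochastic oracles *)

Section mean.
Context {R : realType} (dX : measure_display) (Xi : measurableType dX)
  (D : probability Xi R).
Implicit Types (X Y : Xi -> R) (m : R).
Local Open Scope ereal_scope.

Definition has_mean X m := X \in Lfun D 1 /\ 'E_D[X] = m%:E.

Lemma has_meanP X m :
  has_mean X m <-> D.-integrable setT (EFin \o X) /\ \int[D]_s (X s)%:E = m%:E.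
Proof. by rewrite /has_mean unlock; split=> -[/Lfun1_integrable]. Qed.

Lemma has_mean_measurable X m : has_mean X m -> measurable_fun setT X.
Proof. by move=> /has_meanP[/integrableP[/measurable_EFinP]]. Qed.

Lemma has_mean_cst m : has_mean (fun=> m) m.
Proof. by split; [exact: Lfun_cst|exact: expectation_cst]. Qed.

Lemma has_meanD X Y m m' : has_mean X m -> has_mean Y m' ->
  has_mean (fun s => X s + Y s)%R (m + m').
Proof.
move=> [iX EX] [iY EY]; split; first exact: rpredD.
by rewrite expectationD// EX EY.
Qed.

Lemma has_meanZ a X m : has_mean X m -> has_mean (fun s => a * X s)%R (a * m).
Proof.
move=> [iX EX]; have -> : (fun s => a * X s)%R = (a \o* X)%R.
  by apply/funext => s; rewrite /= mulrC.
by split; [exact: Lfun_scale|rewrite expectationZl// EX].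
Qed.

Lemma has_mean_sum n (X : 'I_n -> Xi -> R) (m : 'I_n -> R) :
  (forall i, has_mean (X i) (m i)) ->
  has_mean (fun s => \sum_(i < n) X i s)%R (\sum_(i < n) m i).
Proof.
elim: n X m => [|n IHn] X m mean_X.
  rewrite big_ord0; under [fun s => _]eq_fun do rewrite big_ord0.
  exact: has_mean_cst.
rewrite big_ord_recr; under [fun s => _]eq_fun do rewrite big_ord_recr.
by apply: has_meanD => //; exact: IHn.
Qed.

Lemma has_mean_le X Y m m' : has_mean X m -> has_mean Y m' ->
  (forall s, X s <= Y s)%R -> (m <= m')%R.
Proof.
move=> /has_meanP[iX EX] /has_meanP[iY EY] XY; rewrite -lee_fin -EX -EY.
by apply: le_integral => // s _; rewrite lee_fin.
Qed.

Lemma ge0_has_mean X m : measurable_fun setT X -> (forall s, 0 <= X s)%R ->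
  'E_D[X] <= m%:E -> exists2 m', has_mean X m' & (m' <= m)%R.
Proof.
move=> mX X0 EX_le; have EX0 := expectation_ge0 D X0.
have EX_fin : 'E_D[X] \is a fin_num.
  by rewrite ge0_fin_numE//; exact: le_lt_trans EX_le (ltry _).
exists (fine 'E_D[X]); last by rewrite -lee_fin fineK.
split; last by rewrite fineK.
apply/Lfun1_integrable/integrableP; split; first exact/measurable_EFinP.
under eq_integral => s _ do rewrite /= ger0_norm//.
by rewrite ltey_eq; move: EX_fin; rewrite unlock => ->.
Qed.

Lemma has_mean_dominated X Y m : measurable_fun setT X ->
  (forall s, 0 <= X s)%R -> (forall s, X s <= Y s)%R -> has_mean Y m ->
  exists2 m', has_mean X m' & (m' <= m)%R.
Proof.
move=> mX X0 XY mean_Y; apply: ge0_has_mean => //; rewrite -mean_Y.2.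
apply: expectation_le => //; first exact: has_mean_measurable mean_Y.
  by move=> s; exact: le_trans (XY s).
exact: aeW.
Qed.

End mean.

Section row_mean.
Context {R : realType} (dX : measure_display) (Xi : measurableType dX)
  (D : probability Xi R) (n : nat).
Implicit Types (X Y : Xi -> 'rV[R]_n) (m : 'rV[R]_n).

Definition has_row_mean X m := forall i, has_mean D (fun s => X s ord0 i) (m ord0 i).

Lemma has_row_mean_measurable X m : has_row_mean X m -> row_measurable X.
Proof. by move=> mean_X i; exact: has_mean_measurable (mean_X i). Qed.

Lemma has_row_mean_cst m : has_row_mean (fun=> m) m.
Proof. by move=> i; exact: has_mean_cst. Qed.

Lemma has_row_meanD X Y m m' : has_row_mean X m -> has_row_mean Y m' ->
  has_row_mean (fun s => X s + Y s) (m + m').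
Proof.
move=> mean_X mean_Y i; rewrite mxE; under [fun s => _]eq_fun do rewrite mxE.
exact: has_meanD.
Qed.

Lemma has_row_meanZ a X m : has_row_mean X m -> has_row_mean (fun s => a *: X s) (a *: m).
Proof.
move=> mean_X i; rewrite mxE; under [fun s => _]eq_fun do rewrite mxE.
exact: has_meanZ.
Qed.

Lemma has_row_meanB X Y m m' : has_row_mean X m -> has_row_mean Y m' ->
  has_row_mean (fun s => X s - Y s) (m - m').
Proof.
move=> mean_X mean_Y; rewrite -scaleN1r; under [fun s => _]eq_fun do rewrite -scaleN1r.
by apply: has_row_meanD => //; exact: has_row_meanZ.
Qed.

Lemma has_mean_dotp u X m :
  has_row_mean X m -> has_mean D (fun s => dotp u (X s)) (dotp u m).
Proof. by move=> mean_X; apply: has_mean_sum => i; exact: has_meanZ. Qed.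

Lemma enorm_mean_le X m (c : R) :
  has_row_mean X m -> (forall s, enorm (X s) <= c) -> enorm m <= c.
Proof.
move=> mean_X X_le; have : dotp m m <= enorm m * c.
  apply: (has_mean_le (has_mean_dotp m mean_X) (has_mean_cst D _)) => s.
  by apply: le_trans (CauchySchwarz_dotp _ _) _; rewrite ler_wpM2l ?enorm_ge0.
have c0 : 0 <= c := le_trans (enorm_ge0 _) (X_le point).
rewrite -enorm_sqr expr2; have := enorm_ge0 m; rewrite le_eqVlt => /predU1P[<-//|m0].
by rewrite ler_pM2l.
Qed.

Lemma has_mean_sqr_enormD a X m (S : R) :
  has_row_mean X m -> has_mean D (fun s => enorm (X s) ^+ 2) S ->
  has_mean D (fun s => enorm (a + X s) ^+ 2) (enorm a ^+ 2 + 2 * dotp a m + S).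
Proof.
move=> mean_X mean_X2.
under [fun s => _]eq_fun => s.
  rewrite enorm_sqr !dotpE (dotpC (X s) a).
  rewrite (_ : _ + _ = enorm a ^+ 2 + 2 * dotp a (X s) + enorm (X s) ^+ 2); last first.
    by rewrite !enorm_sqr; ring.
  over.
apply: has_meanD => //; apply: has_meanD; first exact: has_mean_cst.
by apply: has_meanZ; exact: has_mean_dotp.
Qed.

Lemma variance_le_mean_sqr X m (c : R) : has_row_mean X m ->
  (forall s, enorm (X s) ^+ 2 <= c) ->
  exists2 S, has_mean D (fun s => enorm (X s - m) ^+ 2) S & S <= c.
Proof.
move=> mean_X X_le; have mX := measurable_enorm_sqr (has_row_mean_measurable mean_X).
have [S mean_X2 Sc] := has_mean_dominated mX (fun s => sqr_ge0 _) X_le (has_mean_cst D c).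
exists (enorm (- m) ^+ 2 + 2 * dotp (- m) m + S).
  by under [fun s => _]eq_fun do rewrite addrC; exact: has_mean_sqr_enormD.
by rewrite enormN dotpNl -enorm_sqr; have := sqr_ge0 (enorm m); lra.
Qed.

Definition momentum_update (b : R) (u g0 g1 : 'rV[R]_n) : 'rV[R]_n :=
  g1 + (1 - b) *: (u - g0).

(* The error is [(1 - b) (m0 - u)] plus the centred noise
   [b (m1 - g1) - (1 - b) ((g1 - g0) - (m1 - m0))]: there is no cross term in the
   mean square. *)
Lemma momentum_update_mse_le (g0 g1 : Xi -> 'rV[R]_n) (m0 m1 u : 'rV[R]_n) (b C sg : R) :
  has_row_mean g0 m0 -> has_row_mean g1 m1 ->
  (forall s, enorm (g1 s - g0 s) ^+ 2 <= C) ->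
  ('E_D[(fun s => enorm (m1 - g1 s) ^+ 2)%R] <= sg%:E)%E ->
  ('E_D[(fun s => enorm (m1 - momentum_update b u (g0 s) (g1 s)) ^+ 2)%R]
   <= (momentum_mse b sg C (enorm (m0 - u) ^+ 2))%:E)%E.
Proof.
move=> mean0 mean1 incr_le var_le.
pose err s := m1 - g1 s; pose incr s := (g1 s - g0 s) - (m1 - m0).
pose noise s := b *: err s - (1 - b) *: incr s.
have mean_err : has_row_mean err (m1 - m1).
  exact: has_row_meanB (has_row_mean_cst _) mean1.
have mean_incr : has_row_mean incr ((m1 - m0) - (m1 - m0)).
  by apply: has_row_meanB (has_row_mean_cst _); exact: has_row_meanB.
have := has_row_meanB (has_row_meanZ b mean_err) (has_row_meanZ (1 - b) mean_incr).
rewrite !subrr !scaler0 subr0 -/noise => mean_noise.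
have [Serr mean_err2 Serr_le] := ge0_has_mean
  (measurable_enorm_sqr (has_row_mean_measurable mean_err)) (fun s => sqr_ge0 _) var_le.
have [Sincr mean_incr2 Sincr_le] :=
  variance_le_mean_sqr (has_row_meanB mean1 mean0) incr_le.
have noise_le s : enorm (noise s) ^+ 2
    <= 2 * b ^+ 2 * enorm (err s) ^+ 2 + 2 * (1 - b) ^+ 2 * enorm (incr s) ^+ 2.
  apply: le_trans (enorm_sqrD_le _ _) _.
  by rewrite enormN !enormZ !exprMn !real_normK ?num_real// mulrDr !mulrA.
have [S mean_noise2 S_le] := has_mean_dominated
  (measurable_enorm_sqr (has_row_mean_measurable mean_noise)) (fun s => sqr_ge0 _) noise_le
  (has_meanD (has_meanZ _ mean_err2) (has_meanZ _ mean_incr2)).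
have decomposition s :
    m1 - momentum_update b u (g0 s) (g1 s) = (1 - b) *: (m0 - u) + noise s.
  rewrite /noise /err /incr /momentum_update; apply/rowP => i; rewrite !mxE; ring.
under eq_fun do rewrite decomposition.
have [_ ->] := has_mean_sqr_enormD ((1 - b) *: (m0 - u)) mean_noise mean_noise2.
rewrite lee_fin linear0 mulr0 addr0 enormZ exprMn real_normK ?num_real//.
rewrite /momentum_mse -addrA lerD2l.
by apply: le_trans S_le _; apply: lerD; rewrite ler_wpM2l// mulr_ge0 ?sqr_ge0.
Qed.

End row_mean.

Definition jointly_lipschitz (R : realType) (d p n : nat) (K : R)
    (g : 'rV[R]_d -> 'rV[R]_p -> 'rV[R]_n) :=
  forall x y x' y', enorm (g x y - g x' y') <= K * (enorm (x - x') + enorm (y - y')).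

Section jointly_lipschitz.
Context {R : realType} (d p n : nat) (K : R).
Variable g : 'rV[R]_d -> 'rV[R]_p -> 'rV[R]_n.

Lemma jointly_lipschitz_of_partial :
  (forall x x' y, enorm (g x y - g x' y) <= K * enorm (x - x')) ->
  (forall x y y', enorm (g x y - g x y') <= K * enorm (y - y')) ->
  jointly_lipschitz K g.
Proof.
move=> lipx lipy x y x' y'; apply: le_trans (enorm_distD _ (g x' y) _) _.
by rewrite mulrDr lerD.
Qed.

Hypothesis lip_g : jointly_lipschitz K g.

Lemma jointly_lipschitz_fst y : elipschitz K (g ^~ y).
Proof.
move=> x x'; apply: le_trans (lip_g x y x' y) _.
by rewrite subrr enorm0 addr0.
Qed.

Lemma jointly_lipschitz_snd x : elipschitz K (g x).
Proof.
move=> y y'; apply: le_trans (lip_g x y x y') _.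
by rewrite subrr enorm0 add0r.
Qed.

Lemma jointly_lipschitz_sqr x y x' y' :
  enorm (g x y - g x' y') ^+ 2 <= 2 * K ^+ 2 * (enorm (x - x') ^+ 2 + enorm (y - y') ^+ 2).
Proof.
have le0 := le_trans (enorm_ge0 _) (lip_g x y x' y').
apply: (@le_trans _ _ ((K * (enorm (x - x') + enorm (y - y'))) ^+ 2)).
  by rewrite ler_pXn2r ?nnegrE ?enorm_ge0.
rewrite exprMn (mulrC 2) -[leRHS]mulrA ler_wpM2l ?sqr_ge0// -subr_ge0.
have := sqr_ge0 (enorm (x - x') - enorm (y - y')); rewrite sqrrB sqrrD; lra.
Qed.

End jointly_lipschitz.

Lemma row_measurable_jointly_lipschitz (R : realType) (d p n : nat) (K : R)
    (dU : measure_display) (U : measurableType dU)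
    (G : U -> 'rV[R]_d -> 'rV[R]_p -> 'rV[R]_n) (X : U -> 'rV[R]_d) (Y : U -> 'rV[R]_p) :
  (forall x y, row_measurable (fun u => G u x y)) ->
  (forall u, jointly_lipschitz K (G u)) ->
  row_measurable X -> row_measurable Y -> row_measurable (fun u => G u (X u) (Y u)).
Proof.
move=> mG lipG mX mY i.
apply: (measurable_caratheodory (h := fun u y => G u (X u) y ord0 i)) => // [y|u].
  apply: (measurable_caratheodory (h := fun u x => G u x y ord0 i)) => // [x|u].
    exact: mG.
  exact: elipschitz_coord_continuous (jointly_lipschitz_fst (lipG u) y).
exact: elipschitz_coord_continuous (jointly_lipschitz_snd (lipG u) (X u)).
Qed.

Record stochastic_oracle (R : realType) (d p n : nat) (dX : measure_display)
    (Xi : measurableType dX) (D : probability Xi R)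
    (g : Xi -> 'rV[R]_d -> 'rV[R]_p -> 'rV[R]_n)
    (gbar : 'rV[R]_d -> 'rV[R]_p -> 'rV[R]_n) (K sg : R) : Prop := {
  oracle_mean : forall x y, has_row_mean D (fun s => g s x y) (gbar x y);
  oracle_variance : forall x y,
    ('E_D[(fun s => enorm (gbar x y - g s x y) ^+ 2)%R] <= sg%:E)%E;
  oracle_lipschitz : forall s, jointly_lipschitz K (g s) }.

Section stochastic_oracle.
Context {R : realType} (d p n : nat) (dX : measure_display) (Xi : measurableType dX)
  (D : probability Xi R).
Variables (g : Xi -> 'rV[R]_d -> 'rV[R]_p -> 'rV[R]_n)
  (gbar : 'rV[R]_d -> 'rV[R]_p -> 'rV[R]_n) (K sg : R).
Hypothesis oracle : stochastic_oracle D g gbar K sg.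

Lemma jointly_lipschitz_mean : jointly_lipschitz K gbar.
Proof.
move=> x y x' y'.
have mean_diff := has_row_meanB (oracle_mean oracle x y) (oracle_mean oracle x' y').
by apply: (enorm_mean_le mean_diff) => s; exact: (oracle_lipschitz oracle).
Qed.

Context {dU : measure_display} {U : measurableType dU}.
Implicit Types (X : U -> 'rV[R]_d) (Y : U -> 'rV[R]_p).

Lemma row_measurable_mean X Y :
  row_measurable X -> row_measurable Y -> row_measurable (fun u => gbar (X u) (Y u)).
Proof.
apply: (row_measurable_jointly_lipschitz (G := fun=> gbar)) => [x y|_].
  exact: row_measurable_cst.
exact: jointly_lipschitz_mean.
Qed.

Lemma row_measurable_oracle (S : U -> Xi) X Y : measurable_fun setT S ->
  row_measurable X -> row_measurable Y -> row_measurable (fun u => g (S u) (X u) (Y u)).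
Proof.
move=> mS; apply: (row_measurable_jointly_lipschitz (G := fun u => g (S u))) => [x y|u].
  exact: row_measurable_comp mS (has_row_mean_measurable (oracle_mean oracle x y)).
exact: (oracle_lipschitz oracle).
Qed.

Lemma row_measurable_momentum_update b (S : U -> Xi) X X' Y Y' (e : U -> 'rV[R]_n) :
  measurable_fun setT S -> row_measurable X -> row_measurable X' ->
  row_measurable Y -> row_measurable Y' -> row_measurable e ->
  row_measurable (fun u =>
    momentum_update b (e u) (g (S u) (X u) (Y u)) (g (S u) (X' u) (Y' u))).
Proof.
move=> mS mX mX' mY mY' me; apply: row_measurableD; first exact: row_measurable_oracle.
by apply: row_measurableZ; apply: row_measurableB => //; exact: row_measurable_oracle.
Qed.

End stochastic_oracle.

(** * Expectations of nonnegative random variables *)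

Section nonneg_expectation.
Context {R : realType} (dO : measure_display) (Omega : measurableType dO)
  (P : probability Omega R).
Implicit Types (X Y : Omega -> R).

Definition nonneg_rv X := measurable_fun setT X /\ forall o, 0 <= X o.

Lemma nonneg_rv_cst (c : R) : 0 <= c -> nonneg_rv (fun=> c).
Proof. by move=> c0; split => //; exact: measurable_cst. Qed.

Lemma nonneg_rvD X Y : nonneg_rv X -> nonneg_rv Y -> nonneg_rv (fun o => X o + Y o).
Proof.
move=> [mX X0] [mY Y0]; split; first exact: measurable_funD.
by move=> o; exact: addr_ge0.
Qed.

Lemma nonneg_rvZ (c : R) X : 0 <= c -> nonneg_rv X -> nonneg_rv (fun o => c * X o).
Proof.
move=> c0 [mX X0]; split; first exact: measurable_funM.
by move=> o; exact: mulr_ge0.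
Qed.

Lemma nonneg_rv_enorm n (u : Omega -> 'rV[R]_n) :
  row_measurable u -> nonneg_rv (fun o => enorm (u o)).
Proof. by move=> mu; split; [exact: measurable_enorm|move=> o; exact: enorm_ge0]. Qed.

Lemma nonneg_rv_enorm_sqr n (u : Omega -> 'rV[R]_n) :
  row_measurable u -> nonneg_rv (fun o => enorm (u o) ^+ 2).
Proof. by move=> mu; split; [exact: measurable_enorm_sqr|move=> o; exact: sqr_ge0]. Qed.

Lemma nonneg_rv_momentum_mse (b sg : R) X Y : 0 <= sg -> nonneg_rv X -> nonneg_rv Y ->
  nonneg_rv (fun o => momentum_mse b sg (X o) (Y o)).
Proof.
move=> sg0 rvX rvY; apply: nonneg_rvD; first apply: nonneg_rvD.
- by apply: nonneg_rvZ => //; rewrite sqr_ge0.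
- by apply: nonneg_rv_cst; rewrite mulr_ge0// mulr_ge0 ?sqr_ge0.
- by apply: nonneg_rvZ => //; rewrite mulr_ge0 ?sqr_ge0.
Qed.

Local Open Scope ereal_scope.

Lemma ge0_expectationD X Y : nonneg_rv X -> nonneg_rv Y ->
  'E_P[(fun o => X o + Y o)%R] = 'E_P[X] + 'E_P[Y].
Proof.
move=> [mX X0] [mY Y0]; rewrite unlock; under eq_integral do rewrite EFinD.
rewrite ge0_integralD//; first by move=> o _; rewrite lee_fin.
- exact/measurable_EFinP.
- by move=> o _; rewrite lee_fin.
- exact/measurable_EFinP.
Qed.

Lemma ge0_expectationZ (c : R) X : (0 <= c)%R -> nonneg_rv X ->
  'E_P[(fun o => c * X o)%R] = c%:E * 'E_P[X].
Proof.
move=> c0 [mX X0]; rewrite unlock; under eq_integral do rewrite EFinM.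
rewrite ge0_integralZl//; first exact/measurable_EFinP.
by move=> o _; rewrite lee_fin.
Qed.

Lemma ge0_expectation_le X Y : nonneg_rv X -> nonneg_rv Y ->
  (forall o, X o <= Y o)%R -> 'E_P[X] <= 'E_P[Y].
Proof. by move=> [mX X0] [mY Y0] XY; apply: expectation_le => //; exact: aeW. Qed.

(* AM-GM, [X <= (a Y / c + c) / 2], replaces the Cauchy-Schwarz inequality. *)
Lemma expectation_le_of_sqr X Y (a c : R) : (0 <= a)%R -> (0 < c)%R ->
  nonneg_rv X -> nonneg_rv Y -> (forall o, X o ^+ 2 <= a * Y o)%R ->
  'E_P[X] <= (a / (2 * c))%:E * 'E_P[Y] + (c / 2)%:E.
Proof.
move=> a0 c0 rvX rvY XY.
have coef_ge0 : (0 <= a / (2 * c))%R by rewrite divr_ge0// mulr_ge0// ltW.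
have rv_cst : nonneg_rv (fun=> c / 2)%R by apply: nonneg_rv_cst; rewrite divr_ge0// ltW.
have rv_Y := nonneg_rvZ coef_ge0 rvY.
rewrite -(ge0_expectationZ coef_ge0 rvY) -(expectation_cst P (c / 2)).
rewrite -(ge0_expectationD rv_Y rv_cst).
apply: ge0_expectation_le => // [|o]; first exact: nonneg_rvD.
rewrite /= -(ler_pM2l (mulr_gt0 (ltr0Sn R 1) c0)).
have -> : (2 * c * (a / (2 * c) * Y o + c / 2) = a * Y o + c ^+ 2)%R.
  by field; rewrite gt_eqF.
by have := sqr_ge0 (X o - c); rewrite sqrrB; have := XY o; lra.
Qed.

Lemma average_expectation_le (X Y : nat -> Omega -> R) (T : nat) (a S B : R) :
  (1 <= T)%N -> (0 <= a)%R -> (0 <= B)%R ->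
  (forall t, (1 <= t)%N -> nonneg_rv (X t)) -> (forall t, (1 <= t)%N -> nonneg_rv (Y t)) ->
  (forall t o, (1 <= t)%N -> X t o ^+ 2 <= a * Y t o)%R ->
  \sum_(1 <= t < T.+1) 'E_P[Y t] <= S%:E -> (a * S <= T%:R * B ^+ 2)%R ->
  (T%:R^-1)%:E * \sum_(1 <= t < T.+1) 'E_P[X t] <= B%:E.
Proof.
move=> T1 a0 B0 rvX rvY XY sumY S_le; have T0 : (0 < T%:R :> R)%R by rewrite ltr0n.
apply/lee_addgt0Pr => e e0; have c0 : (0 < B + e)%R by rewrite ltr_wpDl.
set c := (B + e)%R in c0; rewrite -EFinD -/c lee_pdivrMl// -EFinM.
have coef_ge0 : (0 <= a / (2 * c))%R by rewrite divr_ge0// mulr_ge0// ltW.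
apply: (@le_trans _ _ (\sum_(1 <= t < T.+1) ((a / (2 * c))%:E * 'E_P[Y t] + (c / 2)%:E))).
  rewrite big_nat_cond [leRHS]big_nat_cond; apply: lee_sum => t /andP[/andP[t1 _] _].
  by apply: expectation_le_of_sqr => // [||o]; [exact: rvX|exact: rvY|exact: XY].
rewrite big_split/= sumEFin big_const_nat subn1/= iter_addr_0.
rewrite big_nat_cond -ge0_sume_distrr -?big_nat_cond; last first.
  by move=> t /andP[/andP[t1 _] _]; apply: expectation_ge0; exact: (rvY t t1).2.
apply: le_trans (leeD (lee_wpmul2l _ sumY) (lexx _)) _; first by rewrite lee_fin.
rewrite -EFinM -EFinD lee_fin -(ler_pM2l (mulr_gt0 (ltr0Sn R 1) c0)).
have -> : (2 * c * (a / (2 * c) * S + c / 2 *+ T) = a * S + T%:R * c ^+ 2)%R.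
  by rewrite -[(_ *+ T)%R]mulr_natl; field; rewrite gt_eqF.
have : (T%:R * B ^+ 2 <= T%:R * c ^+ 2)%R.
  by rewrite ler_pM2l// ler_pXn2r ?nnegrE ?(ltW c0)// lerDl ltW.
by move: S_le; lra.
Qed.

End nonneg_expectation.

Lemma telescope_le (R : realType) (a b : nat -> \bar R) (n : nat -> R) (T : nat) :
  (forall t, (1 <= t)%N -> (a t.+1 + b t <= a t + (n t)%:E)%E) ->
  (a T.+1 + \sum_(1 <= t < T.+1) b t <= a 1%N + (\sum_(1 <= t < T.+1) n t)%:E)%E.
Proof.
move=> step; elim: T => [|T IHT]; first by rewrite !big_geq.
rewrite (big_nat_recr T.+1 _ b)//= (big_nat_recr T.+1 _ n)//= EFinD.
rewrite (addeC (\sum_(1 <= t < T.+1) b t)%E) addeA.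
apply: le_trans (leeD (step T.+1 isT) (lexx _)) _.
by rewrite addeAC addeA; exact: leeD.
Qed.

Lemma stochastic_oracles_of_joint_variance (R : realType) (d p n1 n2 : nat)
    (dX : measure_display) (Xi : measurableType dX) (D : probability Xi R)
    (g1 : Xi -> 'rV[R]_d -> 'rV[R]_p -> 'rV[R]_n1)
    (g2 : Xi -> 'rV[R]_d -> 'rV[R]_p -> 'rV[R]_n2)
    (gbar1 : 'rV[R]_d -> 'rV[R]_p -> 'rV[R]_n1)
    (gbar2 : 'rV[R]_d -> 'rV[R]_p -> 'rV[R]_n2)
    (K sg : R) :
  (forall x y, has_row_mean D (fun s => g1 s x y) (gbar1 x y)) ->
  (forall x y, has_row_mean D (fun s => g2 s x y) (gbar2 x y)) ->
  (forall x y, (\int[D]_s (enorm (gbar1 x y - g1 s x y) ^+ 2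
                            + enorm (gbar2 x y - g2 s x y) ^+ 2)%:E <= sg%:E)%E) ->
  (forall s, jointly_lipschitz K (g1 s)) -> (forall s, jointly_lipschitz K (g2 s)) ->
  stochastic_oracle D g1 gbar1 K sg /\ stochastic_oracle D g2 gbar2 K sg.
Proof.
move=> mean1 mean2 var_le lip1 lip2.
have rv1 x y : nonneg_rv (fun s => enorm (gbar1 x y - g1 s x y) ^+ 2).
  apply: nonneg_rv_enorm_sqr; apply: row_measurableB; first exact: row_measurable_cst.
  exact: has_row_mean_measurable (mean1 x y).
have rv2 x y : nonneg_rv (fun s => enorm (gbar2 x y - g2 s x y) ^+ 2).
  apply: nonneg_rv_enorm_sqr; apply: row_measurableB; first exact: row_measurable_cst.
  exact: has_row_mean_measurable (mean2 x y).
have {}var_le x y : ('E_D[(fun s => enorm (gbar1 x y - g1 s x y) ^+ 2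
    + enorm (gbar2 x y - g2 s x y) ^+ 2)%R] <= sg%:E)%E by rewrite unlock.
split; split => // x y; apply: le_trans (var_le x y).
  apply: ge0_expectation_le => // [|s]; first exact: nonneg_rvD.
  by rewrite lerDl sqr_ge0.
apply: ge0_expectation_le => // [|s]; first exact: nonneg_rvD.
by rewrite lerDr sqr_ge0.
Qed.

Section momentum_past.
Context {R : realType} (d p n : nat) (dO dX : measure_display) (Omega : measurableType dO)
  (Xi : measurableType dX) (P : probability Omega R) (D : probability Xi R).
Variables (xi : nat -> Omega -> Xi) (g : Xi -> 'rV[R]_d -> 'rV[R]_p -> 'rV[R]_n)
  (gbar : 'rV[R]_d -> 'rV[R]_p -> 'rV[R]_n) (K sg : R).
Hypothesis iid : iid_samples P D xi.
Hypothesis oracle : stochastic_oracle D g gbar K sg.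

Local Notation past_row_measurable t := (@row_measurable R _ (past xi t) _).

Lemma oracle_sg_ge0 : 0 <= sg.
Proof.
rewrite -lee_fin; apply: le_trans (oracle_variance oracle 0 0).
by apply: expectation_ge0 => s; exact: sqr_ge0.
Qed.

Lemma oracle_mse_sample t x y : (0 < t)%N ->
  ('E_P[(fun o => enorm (gbar x y - g (xi t o) x y) ^+ 2)%R] <= sg%:E)%E.
Proof.
move=> t0; have := oracle_variance oracle x y; rewrite unlock.
rewrite -(ge0_integral_sample iid t0)// => [|s]; last by rewrite lee_fin sqr_ge0.
apply/measurable_EFinP; apply: measurable_enorm_sqr.
apply: row_measurableB; first exact: row_measurable_cst.
exact: has_row_mean_measurable (oracle_mean oracle x y).
Qed.

Lemma momentum_update_mse_past t b (X X' : Omega -> 'rV[R]_d) (Y Y' : Omega -> 'rV[R]_p)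
    (u : Omega -> 'rV[R]_n) :
  past_row_measurable t X -> past_row_measurable t X' ->
  past_row_measurable t Y -> past_row_measurable t Y' -> past_row_measurable t u ->
  ('E_P[(fun o => enorm (gbar (X' o) (Y' o) - momentum_update b (u o)
            (g (xi t.+1 o) (X o) (Y o)) (g (xi t.+1 o) (X' o) (Y' o))) ^+ 2)%R]
   <= 'E_P[(fun o => momentum_mse b sg
            (2 * K ^+ 2 * (enorm (X' o - X o) ^+ 2 + enorm (Y' o - Y o) ^+ 2))
            (enorm (gbar (X o) (Y o) - u o) ^+ 2))%R])%E.
Proof.
move=> mX mX' mY mY' mu.
pose err (z : past xi t * Xi) := enorm (gbar (X' z.1) (Y' z.1) - momentum_update b (u z.1)
  (g z.2 (X z.1) (Y z.1)) (g z.2 (X' z.1) (Y' z.1))) ^+ 2.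
have mfst q (Z : Omega -> 'rV[R]_q) : past_row_measurable t Z ->
    row_measurable (fun z : past xi t * Xi => Z z.1).
  by move=> mZ; exact: row_measurable_comp measurable_fst mZ.
have mO q (Z : Omega -> 'rV[R]_q) : past_row_measurable t Z -> row_measurable Z.
  by move=> mZ; exact: (row_measurable_past iid mZ).
have merr : measurable_fun setT (EFin \o err).
  apply/measurable_EFinP; apply: measurable_enorm_sqr; apply: row_measurableB.
    by apply: (row_measurable_mean oracle); exact: mfst.
  by apply: (row_measurable_momentum_update oracle _ measurable_snd); exact: mfst.
have err0 z : (0 <= (EFin \o err) z)%E by rewrite lee_fin sqr_ge0.
have tonelli := tonelli_past iid merr err0; rewrite /= in tonelli.
rewrite unlock tonelli; apply: ge0_le_integral => //.
- by move=> o _; apply: integral_ge0 => s _; exact: (err0 (o, s)).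
- exact: (measurable_integral_sample iid merr err0).
- apply/measurable_EFinP; apply: (proj1 (nonneg_rv_momentum_mse _ oracle_sg_ge0 _ _)).
    apply: nonneg_rvZ; first by rewrite mulr_ge0 ?sqr_ge0.
    by apply: nonneg_rvD; apply: nonneg_rv_enorm_sqr; apply: row_measurableB; exact: mO.
  apply: nonneg_rv_enorm_sqr; apply: row_measurableB; last exact: mO.
  by apply: (row_measurable_mean oracle); exact: mO.
- move=> o _; have := momentum_update_mse_le (u o) b (oracle_mean oracle (X o) (Y o))
    (oracle_mean oracle (X' o) (Y' o)) _ (oracle_variance oracle (X' o) (Y' o)).
  rewrite unlock; apply=> s.
  exact: jointly_lipschitz_sqr (oracle_lipschitz oracle s) _ _ _ _.
Qed.

End momentum_past.

(** * Step sizes *)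

Section cube_root.
Context {R : realType}.
Implicit Types (a b k m x : R) (n t T : nat).

Lemma powR_invnK x n : 0 <= x -> (x `^ n.+1%:R^-1) ^+ n.+1 = x.
Proof.
move=> x0; rewrite -powR_mulrn ?powR_ge0// -powRrM mulVf ?pnatr_eq0//.
by rewrite powRr1.
Qed.

Lemma cbrtK x : 0 <= x -> (x `^ 3^-1) ^+ 3 = x.
Proof. exact: (@powR_invnK x 2). Qed.

Lemma ler_cbrt a b : 0 <= a -> a <= b -> a `^ 3^-1 <= b `^ 3^-1.
Proof. by move=> a0 ab; rewrite ge0_ler_powR ?nnegrE// (le_trans a0). Qed.

Lemma ler_cbrt_of_cube a b : 0 <= a -> 0 <= b -> a ^+ 3 <= b -> a <= b `^ 3^-1.
Proof. by move=> a0 b0 ab; rewrite -(@ler_pXn2r _ 3) ?nnegrE ?powR_ge0// cbrtK. Qed.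

Lemma ler_cbrtD a b : 0 <= a -> 0 <= b -> (a + b) `^ 3^-1 <= a `^ 3^-1 + b `^ 3^-1.
Proof.
move=> a0 b0; rewrite -(@ler_pXn2r _ 3) ?nnegrE ?addr_ge0 ?powR_ge0//.
rewrite cbrtK ?addr_ge0// -{1}(cbrtK a0) -{1}(cbrtK b0).
move: (powR_ge0 a 3^-1) (powR_ge0 b 3^-1); set u := a `^ _; set v := b `^ _ => u0 v0.
have -> : (u + v) ^+ 3 = u ^+ 3 + v ^+ 3 + 3 * (u * v) * (u + v) by ring.
by rewrite lerDl mulr_ge0 ?addr_ge0// mulr_ge0// mulr_ge0.
Qed.

Lemma cbrtS_sub_le k x : 0 < k -> 2 <= x -> k ^+ 3 <= x ->
  ((x + 1) `^ 3^-1 - x `^ 3^-1) * (3 * k * (x + 1) `^ 3^-1) <= 2.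
Proof.
move=> k0 x2 kx; have x0 : 0 <= x by lra.
have x10 : 0 <= x + 1 by lra.
have kb : k <= (x + 1) `^ 3^-1 by apply: ler_cbrt_of_cube; [exact: ltW| |lra].
have b_le : (x + 1) `^ 3^-1 / 2 <= x `^ 3^-1.
  apply: ler_cbrt_of_cube; rewrite ?divr_ge0 ?powR_ge0// expr_div_n cbrtK//.
  by rewrite ler_pdivrMr ?exprn_gt0//; lra.
have ab : x `^ 3^-1 <= (x + 1) `^ 3^-1 by apply: ler_cbrt => //; lra.
have := cbrtK x0; have := cbrtK x10.
move: kb b_le ab (powR_ge0 x 3^-1) (powR_ge0 (x + 1) 3^-1).
set b := (x + 1) `^ _; set a := x `^ _ => kb b_le ab a0 b0 bE aE.
apply: (@le_trans _ _ ((b - a) * (2 * (b ^+ 2 + b * a + a ^+ 2)))).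
  rewrite ler_wpM2l ?subr_ge0//.
  have := ler_wpM2r b0 kb; have := ler_wpM2l b0 b_le; have := sqr_ge0 a.
  by lra.
have -> : (b - a) * (2 * (b ^+ 2 + b * a + a ^+ 2)) = 2 * (b ^+ 3 - a ^+ 3) by ring.
by rewrite bE aE; lra.
Qed.

Lemma sum_inv_le_ln m T : 1 <= m -> \sum_(1 <= t < T.+1) (m + t%:R)^-1 <= ln (m + T%:R).
Proof.
move=> m1; elim: T => [|T IHT]; first by rewrite big_geq// addr0 ln_ge0.
rewrite big_nat_recr//=; set x := m + T.+1%:R.
have xE : m + T%:R = x - 1 by rewrite /x -(natr1 T) addrA addrK.
have x1 : 0 < x - 1 by rewrite -xE; have : 0 <= T%:R :> R by []; lra.
have x0 : 0 < x by lra.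
apply: le_trans (lerD IHT (lexx _)) _; rewrite xE -lerBrDr.
rewrite (_ : x - 1 = x * (1 - x^-1)); last by rewrite mulrBr mulfV ?gt_eqF// mulr1.
have x1V : 0 < 1 - x^-1 by rewrite -(pmulr_rgt0 _ x0) mulrBr mulfV ?gt_eqF// mulr1.
by rewrite lnM ?posrE// lerD2l; apply: le_ln1Dx; lra.
Qed.

Definition cbrt_step k m t : R := k / (m + t%:R) `^ 3^-1.

Section cbrt_step.
Variables (k m : R).
Hypotheses (k_gt0 : 0 < k) (m_ge2 : 2 <= m) (m_ge : k ^+ 3 <= m).

Let m_gt0 : 0 < m. Proof. exact: lt_le_trans m_ge2. Qed.

Let mt_gt0 t : 0 < m + t%:R. Proof. by rewrite ltr_wpDr. Qed.

Let root_gt0 t : 0 < (m + t%:R) `^ 3^-1. Proof. exact: powR_gt0. Qed.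

Lemma cbrt_step01 t : 0 < cbrt_step k m t <= 1.
Proof.
rewrite divr_gt0//= ler_pdivrMr// mul1r.
apply: ler_cbrt_of_cube; rewrite ?(ltW k_gt0) ?(ltW (mt_gt0 t))//.
by rewrite (le_trans m_ge)// lerDl.
Qed.

Lemma cbrt_step_le t T : (t <= T)%N -> cbrt_step k m T <= cbrt_step k m t.
Proof.
move=> tT; rewrite ler_wpM2l ?(ltW k_gt0)// lef_pV2 ?posrE//.
by rewrite ler_cbrt ?(ltW (mt_gt0 t))// lerD2l ler_nat.
Qed.

Lemma cbrt_step_cube t : cbrt_step k m t ^+ 3 = k ^+ 3 * (m + t%:R)^-1.
Proof. by rewrite expr_div_n cbrtK// ltW. Qed.

Lemma cbrt_step_drift t : (1 <= t)%N ->
  (cbrt_step k m t)^-1 - (cbrt_step k m t.-1)^-1 <= 2 / (3 * k ^+ 3) * cbrt_step k m t.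
Proof.
case: t => // t _; rewrite /cbrt_step /= -(natr1 t) addrA; set x := m + t%:R.
have x2 : 2 <= x by rewrite (le_trans m_ge2)// lerDl.
have x10 : 0 < (x + 1) `^ 3^-1 by rewrite powR_gt0//; lra.
have kx : k ^+ 3 <= x by rewrite (le_trans m_ge)// lerDl.
have := cbrtS_sub_le k_gt0 x2 kx; rewrite !invf_div -mulrBl.
rewrite -ler_pdivlMr; last by rewrite !mulr_gt0.
have -> : 2 / (3 * k ^+ 3) * (k / (x + 1) `^ 3^-1) = 2 / (3 * k * (x + 1) `^ 3^-1) / k.
  by field; rewrite !gt_eqF.
by rewrite ler_pM2r ?invr_gt0.
Qed.

Lemma cbrt_step_mul_le c t : 2 * c * k <= m `^ 3^-1 -> 2 * (cbrt_step k m t * c) <= 1.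
Proof.
move=> ck; have -> : 2 * (cbrt_step k m t * c) = 2 * c * k / (m + t%:R) `^ 3^-1.
  by rewrite /cbrt_step; ring.
rewrite ler_pdivrMr// mul1r; apply: le_trans ck _.
by rewrite ler_cbrt ?lerDl// ltW.
Qed.

Lemma sum_cbrt_step_cube T :
  \sum_(1 <= t < T.+1) cbrt_step k m t ^+ 3 <= k ^+ 3 * ln (m + T%:R).
Proof.
under eq_bigr do rewrite cbrt_step_cube.
rewrite -mulr_sumr ler_wpM2l ?exprn_ge0 ?(ltW k_gt0)// sum_inv_le_ln//.
by apply: le_trans m_ge2; rewrite ler1n.
Qed.

End cbrt_step.

Definition msgda_rate (h m T : R) : R :=
  2 * Num.sqrt (3 * h) * m `^ 6^-1 / T `^ 2^-1 + 2 * Num.sqrt (3 * h) / T `^ 3^-1.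

Lemma msgda_rate_ge0 h m (T : R) : 0 <= msgda_rate h m T.
Proof.
by rewrite addr_ge0// divr_ge0 ?powR_ge0// mulr_ge0 ?powR_ge0// mulr_ge0 ?sqrtr_ge0.
Qed.

Lemma le_msgda_rate_sqr h m (T : R) : 0 <= h -> 0 < m -> 0 < T ->
  12 * h * (m + T) `^ 3^-1 <= T * msgda_rate h m T ^+ 2.
Proof.
move=> h0 m0 T0; have sE : Num.sqrt (3 * h) ^+ 2 = 3 * h by rewrite sqr_sqrtr// mulr_ge0.
have uE : (m `^ 6^-1) ^+ 2 = m `^ 3^-1.
  by rewrite -powR_mulrn ?powR_ge0// -powRrM; congr (_ `^ _); field.
have tE : (T `^ 2^-1) ^+ 2 = T by exact: (@powR_invnK T 1 (ltW T0)).
have rE := cbrtK (ltW T0); have := ler_cbrtD (ltW m0) (ltW T0); rewrite -uE /msgda_rate.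
move: sE uE tE rE (sqrtr_ge0 (3 * h)) (powR_ge0 m 6^-1).
move: (powR_gt0 2^-1 T0) (powR_gt0 3^-1 T0).
set s := Num.sqrt _; set u := m `^ _; set t := T `^ 2^-1; set r := T `^ _.
move=> t0 r0 sE uE tE rE s0 u0 root_le.
have sqrE : T * ((2 * s * u / t) ^+ 2 + (2 * s / r) ^+ 2) = 12 * h * (u ^+ 2 + r).
  have -> : (2 * s * u / t) ^+ 2 = 4 * s ^+ 2 * u ^+ 2 / t ^+ 2 by field; rewrite gt_eqF.
  have -> : (2 * s / r) ^+ 2 = 4 * s ^+ 2 * r / r ^+ 3 by field; rewrite gt_eqF.
  by rewrite sE tE rE; field; rewrite gt_eqF.
apply: le_trans (ler_wpM2l _ root_le) _; first by rewrite mulr_ge0.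
rewrite -sqrE ler_wpM2l ?(ltW T0)// sqrrD -addrA lerD2l lerDr mulrn_wge0//.
by rewrite mulr_ge0// divr_ge0 ?(ltW t0) ?(ltW r0)// !mulr_ge0.
Qed.

End cube_root.

(** * Convergence of the algorithm *)

Record admissible_schedule (R : realType) (mu Lf lam c1 c2 : R) (eta : nat -> R) : Prop := {
  schedule01 : forall t, 0 < eta t <= 1;
  schedule_lam : forall t, 2 * (eta t * lam * Lf) <= 1;
  schedule_grady : forall t, (1 <= t)%N ->
    admissible_momentum (9 * Lf ^+ 2 / mu ^+ 2) c1 (eta t.-1) (eta t);
  schedule_gradx : forall t, (1 <= t)%N ->
    admissible_momentum (9 / 4) c2 (eta t.-1) (eta t) }.

Section msgda.
Context {R : realType} (d p : nat) (dO : measure_display) (Omega : measurableType dO)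
  (P : probability Omega R) (dX : measure_display) (Xi : measurableType dX)
  (D : probability Xi R).
Variables (xi : nat -> Omega -> Xi) (gx : Xi -> 'rV[R]_d -> 'rV[R]_p -> 'rV[R]_d)
  (gy : Xi -> 'rV[R]_d -> 'rV[R]_p -> 'rV[R]_p)
  (f : 'rV[R]_d -> 'rV[R]_p -> R) (F : 'rV[R]_d -> R) (Fstar mu Lf sg : R)
  (c1 c2 lam gam : R) (eta : nat -> R) (x1 : 'rV[R]_d) (y1 : 'rV[R]_p)
  (x xtil w : nat -> Omega -> 'rV[R]_d) (y ytil v : nat -> Omega -> 'rV[R]_p).
Hypothesis iid : iid_samples P D xi.
Hypothesis saddle : PL_saddle f F mu Lf.
Hypothesis F_ge : forall x0, Fstar <= F x0.
Hypothesis oracle_x : stochastic_oracle D gx (gradx f) Lf sg.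
Hypothesis oracle_y : stochastic_oracle D gy (grady f) Lf sg.
Hypothesis steps : admissible_steps mu Lf lam gam.
Hypothesis schedule : admissible_schedule mu Lf lam c1 c2 eta.
Hypothesis init : forall o,
  x 1%N o = x1 /\ y 1%N o = y1 /\
  v 1%N o = gy (xi 1%N o) x1 y1 /\ w 1%N o = gx (xi 1%N o) x1 y1.
Hypothesis recursion : forall t o, (1 <= t)%N ->
  [/\ ytil t.+1 o = y t o + lam *: v t o,
      xtil t.+1 o = x t o - gam *: w t o,
      y t.+1 o = y t o + eta t *: (ytil t.+1 o - y t o),
      x t.+1 o = x t o + eta t *: (xtil t.+1 o - x t o) &
      v t.+1 o = momentum_update (c1 * eta t ^+ 2) (v t o)
        (gy (xi t.+1 o) (x t o) (y t o)) (gy (xi t.+1 o) (x t.+1 o) (y t.+1 o))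
      /\ w t.+1 o = momentum_update (c2 * eta t ^+ 2) (w t o)
        (gx (xi t.+1 o) (x t o) (y t o)) (gx (xi t.+1 o) (x t.+1 o) (y t.+1 o))].

Local Notation weight := (gap_weight mu Lf lam gam).

Let mu_gt0 : 0 < mu := PL_saddle_mu_gt0 saddle.
Let Lf_gt0 : 0 < Lf := PL_saddle_Lf_gt0 saddle.
Let gam_gt0 : 0 < gam := admissible_gam_gt0 steps.
Let weight_gt0 : 0 < weight := gap_weight_gt0 mu_gt0 Lf_gt0 steps.
Let sg_ge0 : 0 <= sg := oracle_sg_ge0 oracle_x.
Let eta_gt0 t : 0 < eta t. Proof. by case/andP: (schedule01 schedule t). Qed.

Let x_1 : x 1%N = fun=> x1.
Proof. by apply/funext => o; have [] := init o. Qed.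

Let y_1 : y 1%N = fun=> y1.
Proof. by apply/funext => o; have [_ []] := init o. Qed.

Let v_1 : v 1%N = fun o => gy (xi 1%N o) x1 y1.
Proof. by apply/funext => o; have [_ [_ []]] := init o. Qed.

Let w_1 : w 1%N = fun o => gx (xi 1%N o) x1 y1.
Proof. by apply/funext => o; have [_ [_ []]] := init o. Qed.

Let x_S t : (1 <= t)%N -> x t.+1 = fun o => x t o - (eta t * gam) *: w t o.
Proof.
move=> t1; apply/funext => o; have [_ -> _ -> _] := recursion o t1.
by rewrite (addrC (x t o) (- _)) addrK scalerN scalerA.
Qed.

Let y_S t : (1 <= t)%N -> y t.+1 = fun o => y t o + (eta t * lam) *: v t o.
Proof.
move=> t1; apply/funext => o; have [-> _ -> _ _] := recursion o t1.
by rewrite (addrC (y t o) (_ *: v t o)) addrK scalerA.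
Qed.

Let v_S t : (1 <= t)%N -> v t.+1 = fun o => momentum_update (c1 * eta t ^+ 2) (v t o)
  (gy (xi t.+1 o) (x t o) (y t o)) (gy (xi t.+1 o) (x t.+1 o) (y t.+1 o)).
Proof. by move=> t1; apply/funext => o; have [_ _ _ _ []] := recursion o t1. Qed.

Let w_S t : (1 <= t)%N -> w t.+1 = fun o => momentum_update (c2 * eta t ^+ 2) (w t o)
  (gx (xi t.+1 o) (x t o) (y t o)) (gx (xi t.+1 o) (x t.+1 o) (y t.+1 o)).
Proof. by move=> t1; apply/funext => o; have [_ _ _ _ []] := recursion o t1. Qed.

Local Notation past_row_measurable n := (@row_measurable R _ (past xi n) _).

Let next_point_measurable n t : (1 <= t)%N ->
  past_row_measurable n (x t) -> past_row_measurable n (y t) ->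
  past_row_measurable n (w t) -> past_row_measurable n (v t) ->
  past_row_measurable n (x t.+1) /\ past_row_measurable n (y t.+1).
Proof.
move=> t1 mx my mw mv; split.
  by rewrite x_S//; apply: row_measurableB => //; exact: row_measurableZ.
by rewrite y_S//; apply: row_measurableD => //; exact: row_measurableZ.
Qed.

Lemma iterates_past_measurable n t : (1 <= t <= n)%N ->
  [/\ past_row_measurable n (x t), past_row_measurable n (y t),
      past_row_measurable n (w t) & past_row_measurable n (v t)].
Proof.
elim: t => // -[_ /andP[_ n1]|t IHt /andP[_ tn]].
  have mxi := @measurable_sample_past _ _ _ _ xi 1 n n1.
  rewrite x_1 y_1 w_1 v_1; split; try exact: row_measurable_cst.
    by apply: (row_measurable_oracle oracle_x mxi); exact: row_measurable_cst.
  by apply: (row_measurable_oracle oracle_y mxi); exact: row_measurable_cst.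
have [|mx my mw mv] := IHt; first exact: ltnW.
have mxi := @measurable_sample_past _ _ _ _ xi t.+2 n tn.
have [//|mx' my'] := next_point_measurable _ mx my mw mv.
split=> //; first by rewrite w_S//; exact: (row_measurable_momentum_update oracle_x _ mxi).
by rewrite v_S//; exact: (row_measurable_momentum_update oracle_y _ mxi).
Qed.

Lemma iterates_measurable t : (1 <= t)%N ->
  [/\ row_measurable (x t), row_measurable (y t),
      row_measurable (w t) & row_measurable (v t)].
Proof.
move=> t1; have [|mx my mw mv] := @iterates_past_measurable t t; first by rewrite t1 /=.
by split; apply: (row_measurable_past iid); eassumption.
Qed.

Let gap t o := F (x t o) - f (x t o) (y t o).
Let erry t o := enorm (grady f (x t o) (y t o) - v t o) ^+ 2.
Let errx t o := enorm (gradx f (x t o) (y t o) - w t o) ^+ 2.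
Let move2 t o :=
  2 * Lf ^+ 2 * (enorm (x t.+1 o - x t o) ^+ 2 + enorm (y t.+1 o - y t o) ^+ 2).
Let potential t o := F (x t o) - Fstar + weight * gap t o.
Let lyapunov t o := potential t o + gam / eta t.-1 * (erry t o + errx t o).
Let metric2 t o := sqr_metric f F mu Lf (x t o) (y t o) (w t o).
Let msey t o := momentum_mse (c1 * eta t ^+ 2) sg (move2 t o) (erry t o).
Let msex t o := momentum_mse (c2 * eta t ^+ 2) sg (move2 t o) (errx t o).

Let gam_eta_ge0 t : 0 <= gam / eta t. Proof. by rewrite divr_ge0// ltW. Qed.

Let nonneg_erry t : (1 <= t)%N -> nonneg_rv (erry t).
Proof.
move=> /iterates_measurable[mx my _ mv]; apply: nonneg_rv_enorm_sqr.
by apply: row_measurableB => //; exact: (row_measurable_mean oracle_y).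
Qed.

Let nonneg_errx t : (1 <= t)%N -> nonneg_rv (errx t).
Proof.
move=> /iterates_measurable[mx my mw _]; apply: nonneg_rv_enorm_sqr.
by apply: row_measurableB => //; exact: (row_measurable_mean oracle_x).
Qed.

Let nonneg_move2 t : (1 <= t)%N -> nonneg_rv (move2 t).
Proof.
move=> t1; have [mx my _ _] := iterates_measurable t1.
have [//|mx' my' _ _] := @iterates_measurable t.+1.
apply: nonneg_rvZ; first by rewrite mulr_ge0 ?sqr_ge0.
by apply: nonneg_rvD; apply: nonneg_rv_enorm_sqr; exact: row_measurableB.
Qed.

Let measurable_value t : (1 <= t)%N -> measurable_fun setT (fun o => F (x t o)).
Proof.
move=> /iterates_measurable[mx _ _ _].
apply: (measurable_caratheodory (h := fun=> F)) => // _ z.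
exact: (differentiable_continuous ((smooth_value saddle).1 z)).
Qed.

Let nonneg_gap t : (1 <= t)%N -> nonneg_rv (gap t).
Proof.
move=> t1; split=> [|o]; last by rewrite subr_ge0 (value_ge saddle).
apply: measurable_funB; first exact: measurable_value.
have [mx my _ _] := iterates_measurable t1.
apply: (measurable_caratheodory (h := fun o y0 => f (x t o) y0)) => // [y0|o y0].
  apply: (measurable_caratheodory (h := fun _ x0 => f x0 y0)) => // _ x0.
  exact: (differentiable_continuous ((PL_saddle_smoothx saddle y0).1 x0)).
exact: (differentiable_continuous ((PL_saddle_smoothy saddle (x t o)).1 y0)).
Qed.

Let nonneg_potential t : (1 <= t)%N -> nonneg_rv (potential t).
Proof.
move=> t1; apply: nonneg_rvD.
  split=> [|o]; last by rewrite subr_ge0.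
  by apply: measurable_funB => //; exact: measurable_value.
exact: nonneg_rvZ (ltW weight_gt0) (nonneg_gap t1).
Qed.

Let nonneg_metric2 t : (1 <= t)%N -> nonneg_rv (metric2 t).
Proof.
move=> t1; have [_ _ mw _] := iterates_measurable t1.
apply: nonneg_rvD; last exact: nonneg_errx.
apply: nonneg_rvD; first exact: nonneg_rv_enorm_sqr.
apply: nonneg_rvZ; last exact: nonneg_gap.
by rewrite divr_ge0 ?(ltW mu_gt0)// mulr_ge0 ?sqr_ge0.
Qed.

Let nonneg_lyapunov t : (1 <= t)%N -> nonneg_rv (lyapunov t).
Proof.
move=> t1; apply: nonneg_rvD; first exact: nonneg_potential.
apply: nonneg_rvZ => //; apply: nonneg_rvD; [exact: nonneg_erry|exact: nonneg_errx].
Qed.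

Lemma expectation_erry_le t : (1 <= t)%N -> ('E_P[erry t.+1] <= 'E_P[msey t])%E.
Proof.
move=> t1; have [|mx my mw mv] := @iterates_past_measurable t t; first by rewrite t1 /=.
have [mx' my'] := next_point_measurable t1 mx my mw mv.
have := momentum_update_mse_past iid oracle_y (c1 * eta t ^+ 2) mx mx' my my' mv.
by rewrite /erry v_S.
Qed.

Lemma expectation_errx_le t : (1 <= t)%N -> ('E_P[errx t.+1] <= 'E_P[msex t])%E.
Proof.
move=> t1; have [|mx my mw mv] := @iterates_past_measurable t t; first by rewrite t1 /=.
have [mx' my'] := next_point_measurable t1 mx my mw mv.
have := momentum_update_mse_past iid oracle_x (c2 * eta t ^+ 2) mx mx' my my' mw.
by rewrite /errx w_S.
Qed.

Lemma lyapunov_descent t o : (1 <= t)%N ->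
  potential t.+1 o + gam / eta t * (msey t o + msex t o) + gam * eta t / 4 * metric2 t o
  <= lyapunov t o + 2 * gam * (c1 ^+ 2 + c2 ^+ 2) * eta t ^+ 3 * sg.
Proof.
move=> t1; have := lyapunov_step saddle steps (schedule01 schedule t)
  (schedule_lam schedule t) (x t o) (w t o) (y t o) (v t o) sg
  (schedule_grady schedule t1) (schedule_gradx schedule t1).
rewrite /lyapunov /potential /msey /msex /move2 /metric2 /gap /erry /errx x_S// y_S//.
by lra.
Qed.

Let noise t := 2 * gam * (c1 ^+ 2 + c2 ^+ 2) * eta t ^+ 3 * sg.

Let noise_ge0 t : 0 <= noise t.
Proof.
rewrite mulr_ge0// mulr_ge0 ?exprn_ge0 ?(ltW (eta_gt0 t))// mulr_ge0 ?addr_ge0 ?sqr_ge0//.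
by rewrite mulr_ge0// ltW.
Qed.

Let expectation_lyapunovE t : (1 <= t)%N ->
  ('E_P[lyapunov t] =
   'E_P[potential t] + (gam / eta t.-1)%:E * ('E_P[erry t] + 'E_P[errx t]))%E.
Proof.
move=> t1; have rv_err := nonneg_rvD (nonneg_erry t1) (nonneg_errx t1).
rewrite (ge0_expectationD P (nonneg_potential t1) (nonneg_rvZ (gam_eta_ge0 _) rv_err)).
rewrite (ge0_expectationZ P _ rv_err)//.
by rewrite (ge0_expectationD P (nonneg_erry t1) (nonneg_errx t1)).
Qed.

Lemma expectation_lyapunov_step t : (1 <= t)%N ->
  ('E_P[lyapunov t.+1] + (gam * eta t / 4)%:E * 'E_P[metric2 t]
   <= 'E_P[lyapunov t] + (noise t)%:E)%E.
Proof.
move=> t1; have coef_ge0 : 0 <= gam * eta t / 4 by rewrite divr_ge0// mulr_ge0// ltW.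
have rv_msey : nonneg_rv (msey t).
  by apply: nonneg_rv_momentum_mse; [|exact: nonneg_move2|exact: nonneg_erry].
have rv_msex : nonneg_rv (msex t).
  by apply: nonneg_rv_momentum_mse; [|exact: nonneg_move2|exact: nonneg_errx].
have rv_mse := nonneg_rvD rv_msey rv_msex.
have rv_potential := @nonneg_potential t.+1 isT.
have rv_next := nonneg_rvD rv_potential (nonneg_rvZ (gam_eta_ge0 t) rv_mse).
have rv_metric2 := nonneg_rvZ coef_ge0 (nonneg_metric2 t1).
have rv_noise := nonneg_rv_cst Omega (noise_ge0 t).
rewrite expectation_lyapunovE//= -(ge0_expectationZ P coef_ge0 (nonneg_metric2 t1)).
apply: (@le_trans _ _ ('E_P[potential t.+1]
    + (gam / eta t)%:E * ('E_P[msey t] + 'E_P[msex t])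
    + 'E_P[(fun o => gam * eta t / 4 * metric2 t o)%R])%E).
  rewrite leeD// leeD// lee_wpmul2l ?lee_fin// leeD//.
    exact: expectation_erry_le.
  exact: expectation_errx_le.
rewrite -(ge0_expectationD P rv_msey rv_msex) -(ge0_expectationZ P (gam_eta_ge0 t) rv_mse).
rewrite -(ge0_expectationD P rv_potential (nonneg_rvZ (gam_eta_ge0 t) rv_mse)).
rewrite -(ge0_expectationD P rv_next rv_metric2) -(expectation_cst P (noise t)).
rewrite -(ge0_expectationD P (nonneg_lyapunov t1) rv_noise).
apply: ge0_expectation_le => [||o]; last exact: lyapunov_descent.
  exact: nonneg_rvD.
exact: nonneg_rvD (nonneg_lyapunov t1) rv_noise.
Qed.

Lemma expectation_lyapunov1_le : ('E_P[lyapunov 1] <=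
  (F x1 - Fstar + weight * (F x1 - f x1 y1) + 2 * (gam / eta 0 * sg))%:E)%E.
Proof.
rewrite expectation_lyapunovE// EFinD leeD//.
  by rewrite /potential /gap x_1 y_1 expectation_cst.
have -> : 2 * (gam / eta 0 * sg) = gam / eta 0 * (sg + sg) by ring.
rewrite (EFinM (gam / eta 0)) lee_wpmul2l ?lee_fin// EFinD.
rewrite /erry /errx x_1 y_1 v_1 w_1 leeD//.
  exact: (oracle_mse_sample iid oracle_y).
exact: (oracle_mse_sample iid oracle_x).
Qed.

Lemma sum_expectation_metric2_le T :
  (\sum_(1 <= t < T.+1) (gam * eta t / 4)%:E * 'E_P[metric2 t] <=
   (F x1 - Fstar + weight * (F x1 - f x1 y1) + 2 * (gam / eta 0 * sg)
    + 2 * gam * (c1 ^+ 2 + c2 ^+ 2) * sg * \sum_(1 <= t < T.+1) eta t ^+ 3)%:E)%E.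
Proof.
have := telescope_le T expectation_lyapunov_step.
set S := (\sum_(1 <= t < T.+1) _)%E => telescoped.
apply: (@le_trans _ _ ('E_P[lyapunov T.+1] + S)%E).
  rewrite leeDr//; apply: expectation_ge0; exact: (nonneg_lyapunov _).2.
apply: le_trans telescoped _; rewrite EFinD leeD ?expectation_lyapunov1_le// lee_fin.
by rewrite mulr_sumr; apply: ler_sum => t _; rewrite /noise mulrAC.
Qed.

Let metric t o := Gmetric f F gam mu Lf (x t o) (y t o) (w t o) (xtil t.+1 o).
Let gap_term t o := Num.sqrt 2 * Lf / Num.sqrt mu * Num.sqrt (gap t o).

Let metricE t : (1 <= t)%N ->
  metric t = fun o =>
    enorm (w t o) + gap_term t o + enorm (gradx f (x t o) (y t o) - w t o).
Proof.
move=> t1; apply/funext => o; rewrite /metric /Gmetric; have [_ -> _ _ _] := recursion o t1.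
by rewrite opprB addrCA subrr addr0 enormZ gtr0_norm// mulKf// gt_eqF.
Qed.

Let gap_term_sqr t o : (1 <= t)%N -> gap_term t o ^+ 2 = 2 * Lf ^+ 2 / mu * gap t o.
Proof.
move=> t1; rewrite /gap_term !exprMn exprVn !sqr_sqrtr ?(ltW mu_gt0)//.
exact: (nonneg_gap t1).2.
Qed.

Let gap_term_ge0 t o : 0 <= gap_term t o.
Proof.
by rewrite mulr_ge0 ?sqrtr_ge0// divr_ge0 ?sqrtr_ge0// mulr_ge0 ?sqrtr_ge0// ltW.
Qed.

Let nonneg_metric t : (1 <= t)%N -> nonneg_rv (metric t).
Proof.
move=> t1; rewrite metricE//; have [mx my mw _] := iterates_measurable t1.
apply: nonneg_rvD; last first.
  apply: nonneg_rv_enorm; apply: row_measurableB => //.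
  exact: (row_measurable_mean oracle_x).
apply: nonneg_rvD; first exact: nonneg_rv_enorm.
split=> //; apply: measurable_funM => //.
by apply: measurable_sqrtr; exact: (nonneg_gap t1).1.
Qed.

Lemma metric_sqr_le t o : (1 <= t)%N -> metric t o ^+ 2 <= 3 * metric2 t o.
Proof.
move=> t1; rewrite metricE// /metric2 /sqr_metric -gap_term_sqr//.
set a := enorm (w t o); set b := gap_term t o; set c := enorm _.
have := sqr_ge0 (a - b); have := sqr_ge0 (b - c); have := sqr_ge0 (a - c).
by lra.
Qed.

Lemma enorm_gradient_value_le t o : (1 <= t)%N -> enorm (gradient F (x t o)) <= metric t o.
Proof.
move=> t1; rewrite metricE//.
have grad_gap : enorm (gradient F (x t o) - gradx f (x t o) (y t o)) <= gap_term t o.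
  rewrite -(@ler_pXn2r _ 2) ?nnegrE ?enorm_ge0 ?gap_term_ge0// gap_term_sqr//.
  exact: gradient_value_gap_le.
have := enormD (gradient F (x t o) - w t o) (w t o); rewrite subrK.
have := enorm_distD (gradient F (x t o)) (gradx f (x t o) (y t o)) (w t o).
by lra.
Qed.

Let nonneg_gradient_value t : (1 <= t)%N -> nonneg_rv (fun o => enorm (gradient F (x t o))).
Proof.
move=> /iterates_measurable[mx _ _ _]; apply: nonneg_rv_enorm => i.
apply: (measurable_caratheodory (h := fun _ z => gradient F z ord0 i)) => // _.
exact: elipschitz_coord_continuous (smooth_value saddle).2.
Qed.

Lemma average_gradient_value_le T :
  ((T%:R^-1)%:E * \sum_(1 <= t < T.+1) 'E_P[(fun o => enorm (gradient F (x t o)))]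
   <= (T%:R^-1)%:E * \sum_(1 <= t < T.+1) 'E_P[metric t])%E.
Proof.
apply: lee_wpmul2l; first by rewrite lee_fin invr_ge0.
rewrite big_nat_cond [leRHS]big_nat_cond; apply: lee_sum => t /andP[/andP[t1 _] _].
apply: ge0_expectation_le; [exact: nonneg_gradient_value|exact: nonneg_metric|].
by move=> o; exact: enorm_gradient_value_le.
Qed.

Lemma average_metric_le T B : (1 <= T)%N -> 0 <= B ->
  (forall t, (t <= T)%N -> eta T <= eta t) ->
  12 * (F x1 - Fstar + weight * (F x1 - f x1 y1) + 2 * (gam / eta 0 * sg)
        + 2 * gam * (c1 ^+ 2 + c2 ^+ 2) * sg * \sum_(1 <= t < T.+1) eta t ^+ 3)
  <= T%:R * B ^+ 2 * (gam * eta T) ->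
  ((T%:R^-1)%:E * \sum_(1 <= t < T.+1) 'E_P[metric t] <= B%:E)%E.
Proof.
move=> T1 B0 eta_ge; set budget := F x1 - Fstar + _ + _ + _ => budget_le.
have coef_gt0 : 0 < gam * eta T / 4 by rewrite divr_gt0// mulr_gt0.
apply: (@average_expectation_le _ _ _ _ _ metric2 _ 3 (budget / (gam * eta T / 4))) => //.
- by move=> t o; exact: metric_sqr_le.
- rewrite mulrC EFinM lee_pdivlMl//; apply: le_trans (sum_expectation_metric2_le T).
  rewrite big_nat_cond ge0_sume_distrr -?big_nat_cond; last first.
    by move=> t /andP[/andP[t1 _] _]; apply: expectation_ge0; exact: (nonneg_metric2 t1).2.
  rewrite big_nat_cond [leRHS]big_nat_cond; apply: lee_sum => t /andP[/andP[t1 tT] _].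
  rewrite lee_wpmul2r ?lee_fin ?ler_pM2r ?invr_gt0// ?ler_pM2l ?eta_ge//.
  by apply: expectation_ge0; exact: (nonneg_metric2 t1).2.
by rewrite mulrA ler_pdivrMr//; move: budget_le; lra.
Qed.

End msgda.

Lemma lipschitz_gt0_of_step (R : realType) (lam a b Lf : R) :
  0 < a -> 0 < b -> 0 < lam -> lam <= a / (2 * Lf * b) -> 0 < Lf.
Proof.
move=> a0 b0 lam0 lam_le; have := lt_le_trans lam0 lam_le.
by rewrite pmulr_rgt0// invr_gt0 pmulr_lgt0// pmulr_rgt0.
Qed.

Lemma PL_saddle_of_oracles (R : realType) (d p : nat) (dX : measure_display)
    (Xi : measurableType dX) (D : probability Xi R)
    (gx : Xi -> 'rV[R]_d -> 'rV[R]_p -> 'rV[R]_d)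
    (gy : Xi -> 'rV[R]_d -> 'rV[R]_p -> 'rV[R]_p)
    (f : 'rV[R]_d -> 'rV[R]_p -> R) (F : 'rV[R]_d -> R) (mu Lf sg : R) :
  0 < mu -> 0 < Lf ->
  (forall x y, differentiable (f ^~ y) x /\ differentiable (f x) y) ->
  value_function f F -> (forall x, polyak_lojasiewicz mu (F x) (f x)) ->
  stochastic_oracle D gx (gradx f) Lf sg -> stochastic_oracle D gy (grady f) Lf sg ->
  PL_saddle f F mu Lf.
Proof.
move=> mu0 Lf0 diff_f F_value PL /jointly_lipschitz_mean lipx /jointly_lipschitz_mean lipy.
split=> // [y|x|x|y].
- by split=> [x|]; [exact: (diff_f x y).1|exact: jointly_lipschitz_fst lipx y].
- by split=> [y|]; [exact: (diff_f x y).2|exact: jointly_lipschitz_snd lipy x].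
- exact: jointly_lipschitz_snd lipx x.
- exact: jointly_lipschitz_fst lipy y.
Qed.

Section parameters.
Context {R : realType}.
Variables (mu Lf lam gam k m c1 c2 sg : R).
Hypotheses (mu_gt0 : 0 < mu) (Lf_gt0 : 0 < Lf) (lam_gt0 : 0 < lam) (gam_gt0 : 0 < gam).
Hypotheses (k_gt0 : 0 < k) (m_ge2 : 2 <= m) (m_ge : k ^+ 3 <= m).

Lemma admissible_steps_of_le :
  lam <= 3 / (4 * Num.sqrt 2 * mu) -> gam <= lam * mu / (16 * (Lf * (1 + Lf / mu / 2))) ->
  admissible_steps mu Lf lam gam.
Proof.
move=> lam_le gam_le; split=> //.
  have s2 : 0 < Num.sqrt 2 :> R by rewrite sqrtr_gt0.
  move: lam_le; rewrite ler_pdivlMr ?mulr_gt0// => lam_le.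
  have : (lam * (4 * Num.sqrt 2 * mu)) ^+ 2 <= 3 ^+ 2.
    by rewrite ler_pXn2r ?nnegrE// mulr_ge0 ?(ltW lam_gt0)// !mulr_ge0// ltW.
  by rewrite !exprMn sqr_sqrtr//; lra.
have L0 : 0 < 16 * (Lf * (1 + Lf / mu / 2)).
  by rewrite mulr_gt0// mulr_gt0// ltr_wpDr// !divr_ge0// ltW.
move: gam_le; rewrite ler_pdivlMr//.
by congr (_ <= _); field; rewrite gt_eqF.
Qed.

Lemma admissible_cbrt_schedule :
  lam <= m `^ 3^-1 / (2 * Lf * k) ->
  2 / (3 * k ^+ 3) + 9 * Lf ^+ 2 / mu ^+ 2 <= c1 -> 2 / (3 * k ^+ 3) + 9 / 4 <= c2 ->
  (forall t, (1 <= t)%N ->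
    c1 * cbrt_step k m t ^+ 2 <= 1 /\ c2 * cbrt_step k m t ^+ 2 <= 1) ->
  admissible_schedule mu Lf lam c1 c2 (cbrt_step k m).
Proof.
move=> lam_le c1_ge c2_ge c_le1.
have k3_gt0 : 0 < 2 / (3 * k ^+ 3) by rewrite divr_gt0 ?mulr_gt0 ?exprn_gt0.
have c1_gt0 : 0 < c1.
  by apply: lt_le_trans c1_ge; rewrite ltr_wpDr// divr_ge0 ?sqr_ge0// mulr_ge0 ?sqr_ge0.
have c2_gt0 : 0 < c2 by apply: lt_le_trans c2_ge; rewrite ltr_wpDr.
have drift t q c : (1 <= t)%N -> 2 / (3 * k ^+ 3) + q <= c ->
    (cbrt_step k m t)^-1 - (cbrt_step k m t.-1)^-1 <= (c - q) * cbrt_step k m t.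
  move=> t1 qc; apply: le_trans (cbrt_step_drift k_gt0 m_ge2 m_ge t1) _.
  by rewrite ler_wpM2r ?lerBrDr//; have /andP[/ltW] := cbrt_step01 k_gt0 m_ge2 m_ge t.
split=> [t|t|t t1|t t1]; first exact: cbrt_step01.
- rewrite -mulrA; apply: cbrt_step_mul_le => //.
  by move: lam_le; rewrite ler_pdivlMr ?mulr_gt0//; lra.
- by have [c_le _] := c_le1 t t1; split; [rewrite c_le mulr_ge0 ?sqr_ge0 ?ltW|exact: drift].
- by have [_ c_le] := c_le1 t t1; split; [rewrite c_le mulr_ge0 ?sqr_ge0 ?ltW|exact: drift].
Qed.

Definition rate_constant (V0 gap0 T : R) : R :=
  V0 / (gam * k) + 9 * Lf ^+ 2 / (k * lam * mu ^+ 2) * gap0 + 2 * sg * m `^ 3^-1 / k ^+ 2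
  + 2 * k ^+ 2 * (c1 ^+ 2 + c2 ^+ 2) * sg * ln (m + T).

Lemma rate_constant_ge0 V0 gap0 T : 0 <= sg -> 0 <= V0 -> 0 <= gap0 -> 0 <= T ->
  0 <= rate_constant V0 gap0 T.
Proof.
move=> sg0 V0_ge0 gap0_ge0 T0; have ln0 : 0 <= ln (m + T).
  by rewrite ln_ge0//; move: m_ge2; lra.
have noise_ge0 : 0 <= 2 * k ^+ 2 * (c1 ^+ 2 + c2 ^+ 2) * sg.
  by rewrite mulr_ge0// mulr_ge0 ?addr_ge0 ?sqr_ge0// mulr_ge0// sqr_ge0.
rewrite /rate_constant; apply: addr_ge0 (mulr_ge0 noise_ge0 ln0); apply: addr_ge0.
  apply: addr_ge0; first by rewrite divr_ge0// ltW// mulr_gt0.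
  by rewrite mulr_ge0// divr_ge0 ?ltW// ?mulr_gt0 ?exprn_gt0.
by rewrite divr_ge0 ?sqr_ge0// mulr_ge0 ?powR_ge0// mulr_ge0.
Qed.

Lemma lyapunov_budget_le V0 gap0 (T : nat) :
  0 <= sg -> 0 <= V0 -> 0 <= gap0 -> (1 <= T)%N ->
  12 * (V0 + gap_weight mu Lf lam gam * gap0 + 2 * (gam / cbrt_step k m 0 * sg)
        + 2 * gam * (c1 ^+ 2 + c2 ^+ 2) * sg * \sum_(1 <= t < T.+1) cbrt_step k m t ^+ 3)
  <= T%:R * msgda_rate (rate_constant V0 gap0 T%:R) m T%:R ^+ 2 * (gam * cbrt_step k m T).
Proof.
move=> sg0 V0_ge0 gap0_ge0 T1; set H := rate_constant _ _ _.
have m_gt0 : 0 < m := lt_le_trans (ltr0Sn R 1) m_ge2.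
have T_gt0 : 0 < T%:R :> R by rewrite ltr0n.
have root0_gt0 : 0 < m `^ 3^-1 by exact: powR_gt0.
have rootT_gt0 : 0 < (m + T%:R) `^ 3^-1 by rewrite powR_gt0// addr_gt0.
set c := c1 ^+ 2 + c2 ^+ 2; have c0 : 0 <= c by rewrite addr_ge0 ?sqr_ge0.
have H0 : 0 <= H by rewrite rate_constant_ge0// ltW.
have coef_ge0 : 0 <= 2 * gam * c * sg by rewrite !mulr_ge0// ltW.
apply: (@le_trans _ _ (12 * (gam * k * H))).
  rewrite ler_pM2l// (_ : gam * k * H = V0 + gap_weight mu Lf lam gam * gap0
      + 2 * (gam / cbrt_step k m 0 * sg) + 2 * gam * c * sg * (k ^+ 3 * ln (m + T%:R))).
    by rewrite lerD2l ler_wpM2l// sum_cbrt_step_cube.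
  rewrite /H /rate_constant /gap_weight /cbrt_step addr0 -/c.
  by field; rewrite !gt_eqF.
have coefT_ge0 : 0 <= gam * cbrt_step k m T by rewrite ltW// mulr_gt0// divr_gt0.
apply: le_trans (ler_wpM2r coefT_ge0 (le_msgda_rate_sqr H0 m_gt0 T_gt0)).
rewrite le_eqVlt; apply/orP; left; apply/eqP; rewrite /cbrt_step.
by field; rewrite gt_eqF.
Qed.

End parameters.

Theorem theorem1
  (R : realType) (d p : nat)
  (dO : measure_display) (Omega : measurableType dO) (P : probability Omega R)
  (dX : measure_display) (Xi : measurableType dX) (D : probability Xi R)
  (xi : nat -> Omega -> Xi)
  (fs : Xi -> 'rV[R]_d -> 'rV[R]_p -> R)   (* f(x,y;xi) *)
  (f : 'rV[R]_d -> 'rV[R]_p -> R)          (* f(x,y) *)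
  (F : 'rV[R]_d -> R) (Fstar mu Lf sigma : R)
  (k m c1 c2 lambda gamma : R)
  (x1 : 'rV[R]_d) (y1 : 'rV[R]_p)
  (x xtil w : nat -> Omega -> 'rV[R]_d) (y ytil v : nat -> Omega -> 'rV[R]_p) :
  (* i.i.d. samples xi_1, xi_2, ... with law D *)
  iid_samples P D xi ->
  (* stochastic and deterministic objectives: differentiability, f = E f(.;xi) *)
  (forall s x0 y0, differentiable (fun x' => fs s x' y0) x0 /\
                   differentiable (fun y' => fs s x0 y') y0) ->
  (forall x0 y0, differentiable (fun x' => f x' y0) x0 /\
                 differentiable (fun y' => f x0 y') y0) ->
  (forall x0 y0, D.-integrable setT (fun s => (fs s x0 y0)%:E) /\
                 (f x0 y0)%:E = (\int[D]_s (fs s x0 y0)%:E)%E) ->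
  (* F(x) = max_y f(x,y), with the argmax nonempty *)
  (forall x0, exists ys, (forall y0, f x0 y0 <= f x0 ys) /\ F x0 = f x0 ys) ->
  (* (A1) PL condition in y *)
  0 < mu ->
  (forall x0 y0, enorm (grady f x0 y0) ^+ 2 >= 2 * mu * (F x0 - f x0 y0)) ->
  (* (A2) Lipschitz stochastic partial gradients *)
  (forall s x0 x' y0, enorm (gradx (fs s) x0 y0 - gradx (fs s) x' y0) <= Lf * enorm (x0 - x')) ->
  (forall s x0 y0 y', enorm (gradx (fs s) x0 y0 - gradx (fs s) x0 y') <= Lf * enorm (y0 - y')) ->
  (forall s x0 x' y0, enorm (grady (fs s) x0 y0 - grady (fs s) x' y0) <= Lf * enorm (x0 - x')) ->
  (forall s x0 y0 y', enorm (grady (fs s) x0 y0 - grady (fs s) x0 y') <= Lf * enorm (y0 - y')) ->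
  (* (A3) unbiased stochastic gradients with bounded variance *)
  (forall x0 y0 (i : 'I_d),
      D.-integrable setT (fun s => ((gradx (fs s) x0 y0) ord0 i)%:E) /\
      (\int[D]_s ((gradx (fs s) x0 y0) ord0 i)%:E)%E = ((gradx f x0 y0) ord0 i)%:E) ->
  (forall x0 y0 (j : 'I_p),
      D.-integrable setT (fun s => ((grady (fs s) x0 y0) ord0 j)%:E) /\
      (\int[D]_s ((grady (fs s) x0 y0) ord0 j)%:E)%E = ((grady f x0 y0) ord0 j)%:E) ->
  (forall x0 y0,
      (\int[D]_s (enorm (gradx f x0 y0 - gradx (fs s) x0 y0) ^+ 2
                  + enorm (grady f x0 y0 - grady (fs s) x0 y0) ^+ 2)%:E
       <= (sigma ^+ 2)%:E)%E) ->
  (* (A4) F^* = inf_x F(x) is finite *)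
  (forall x0, Fstar <= F x0) ->
  (forall e, 0 < e -> exists x0, F x0 < Fstar + e) ->
  (* parameters *)
  let kappa := Lf / mu in
  let L := Lf * (1 + kappa / 2) in
  let eta := fun t : nat => k / (m + t%:R) `^ (3^-1) in
  let alpha := fun t : nat => c1 * eta t.-1 ^+ 2 in   (* alpha_{t+1} = c1 eta_t^2 *)
  let beta := fun t : nat => c2 * eta t.-1 ^+ 2 in    (* beta_{t+1} = c2 eta_t^2 *)
  0 < k ->
  Num.max (Num.max 2 (k ^+ 3)) (Num.max ((c1 * k) ^+ 3) ((c2 * k) ^+ 3)) <= m ->
  2 / (3 * k ^+ 3) + 9 * Lf ^+ 2 / mu ^+ 2 <= c1 ->
  2 / (3 * k ^+ 3) + 9 / 4 <= c2 ->
  0 < lambda ->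
  lambda <= Num.min (3 / (4 * Num.sqrt 2 * mu)) (m `^ (3^-1) / (2 * Lf * k)) ->
  0 < gamma ->
  gamma <= Num.min (lambda * mu / (16 * L))
                   (1 / (2 * Lf * Num.sqrt (8 + 9 / (8 * lambda * mu ^+ 2)))) ->
  (* the algorithm requires alpha_t, beta_t in (0,1] *)
  (forall t, (2 <= t)%N -> alpha t <= 1 /\ beta t <= 1) ->
  (* MSGDA iterates *)
  (forall o, x 1%N o = x1 /\ y 1%N o = y1 /\
             v 1%N o = grady (fs (xi 1%N o)) x1 y1 /\
             w 1%N o = gradx (fs (xi 1%N o)) x1 y1) ->
  (forall t o, (1 <= t)%N ->
     [/\ ytil t.+1 o = y t o + lambda *: v t o,
         xtil t.+1 o = x t o - gamma *: w t o,
         y t.+1 o = y t o + eta t *: (ytil t.+1 o - y t o),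
         x t.+1 o = x t o + eta t *: (xtil t.+1 o - x t o) &
        v t.+1 o = grady (fs (xi t.+1 o)) (x t.+1 o) (y t.+1 o)
                    + (1 - alpha t.+1) *: (v t o - grady (fs (xi t.+1 o)) (x t o) (y t o))
        /\ w t.+1 o = gradx (fs (xi t.+1 o)) (x t.+1 o) (y t.+1 o)
                    + (1 - beta t.+1) *: (w t o - gradx (fs (xi t.+1 o)) (x t o) (y t o))]) ->
  (* conclusion *)
  (forall x0, differentiable F x0) /\
  forall T : nat, (1 <= T)%N ->
    let Delta1 := F x1 - f x1 y1 in
    let H := (F x1 - Fstar) / (gamma * k) + 9 * Lf ^+ 2 / (k * lambda * mu ^+ 2) * Delta1
             + 2 * sigma ^+ 2 * m `^ (3^-1) / k ^+ 2
             + 2 * k ^+ 2 * (c1 ^+ 2 + c2 ^+ 2) * sigma ^+ 2 * ln (m + T%:R) in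
    let EgradF := ((T%:R^-1)%:E * \sum_(1 <= t < T.+1)
                    \int[P]_o (enorm (gradient F (x t o)))%:E)%E in
    let EG := ((T%:R^-1)%:E * \sum_(1 <= t < T.+1)
                \int[P]_o (Gmetric f F gamma mu Lf (x t o) (y t o) (w t o) (xtil t.+1 o))%:E)%E in
    (EgradF <= EG)%E /\
    (EG <= (2 * Num.sqrt (3 * H) * m `^ (6^-1) / T%:R `^ (2^-1)
           + 2 * Num.sqrt (3 * H) / T%:R `^ (3^-1))%:E)%E.
Proof.
move=> iid _ diff_f _ F_value mu_gt0 PL lip_xx lip_xy lip_yx lip_yy mean_x mean_y var_xy.
move=> F_ge _ kappa L eta alpha beta k_gt0 m_ge c1_ge c2_ge lam_gt0 lam_le gam_gt0 gam_le.
move=> ab_le1 init rec.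
move: m_ge lam_le gam_le; rewrite !ge_max !le_min -andbA => /and4P[m_ge2 m_gek3 _ _].
move=> /andP[lam_le_mu lam_le_Lf] /andP[gam_le _].
have m_gt0 : 0 < m := lt_le_trans (ltr0Sn R 1) m_ge2.
have Lf_gt0 := lipschitz_gt0_of_step (powR_gt0 _ m_gt0) k_gt0 lam_gt0 lam_le_Lf.
have [oracle_x oracle_y] := stochastic_oracles_of_joint_variance
  (fun x0 y0 i => (has_meanP _ _ _).2 (mean_x x0 y0 i))
  (fun x0 y0 j => (has_meanP _ _ _).2 (mean_y x0 y0 j)) var_xy
  (fun s => jointly_lipschitz_of_partial (lip_xx s) (lip_xy s))
  (fun s => jointly_lipschitz_of_partial (lip_yx s) (lip_yy s)).
have saddle := PL_saddle_of_oracles mu_gt0 Lf_gt0 diff_f F_value PL oracle_x oracle_y.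
have steps := admissible_steps_of_le mu_gt0 Lf_gt0 lam_gt0 gam_gt0 lam_le_mu gam_le.
have schedule := admissible_cbrt_schedule Lf_gt0 k_gt0 m_ge2 m_gek3 lam_le_Lf c1_ge c2_ge
  (fun t t1 => ab_le1 t.+1 t1).
split=> [|T T1 Delta1 H EgradF EG]; first exact: (smooth_value saddle).1.
split.
  have := average_gradient_value_le iid saddle oracle_x oracle_y steps init rec T.
  by rewrite expectation.unlock.
have := average_metric_le iid saddle F_ge oracle_x oracle_y steps schedule init rec T1
  (msgda_rate_ge0 H m T%:R) (fun t tT => cbrt_step_le k_gt0 m_ge2 tT).
rewrite expectation.unlock; apply.
by apply: lyapunov_budget_le; rewrite ?sqr_ge0 ?subr_ge0 ?(value_ge saddle).
Qed.
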